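(* Let $g(z)=\sum_{n=0}^\infty\widehat g(n)z^n\in\mathcal{H}(\mathbb{D})$ be such that $\widehat g(n)\ge0$ for all $n$. Then the following statements are equivalent: (i) $T_g:H^2\to H^\infty$ is bounded; (ii) $\displaystyle\sum_{k=0}^\infty\left(\sum_{n=0}^\infty\frac{(n+1)\widehat g(n+1)}{n+k+1}\right)^2<\infty$; (iii) $T_g:H^2\to H^\infty$ is compact. Moreover, $$\|T_g\|^2_{H^2\to H^\infty}\asymp\sum_{k=0}^\infty\left(\sum_{n=0}^\infty\frac{(n+1)\widehat g(n+1)}{n+k+1}\right)^2.$$
   Context: $\mathbb{D}$ is the open unit disc, $\mathcal{H}(\mathbb{D})$ the space of analytic functions in $\mathbb{D}$, $H^2$ the Hardy space on $\mathbb{D}$, $H^\infty$ the bounded analytic functions with sup norm. $T_g(f)(z)=\int_0^z f(\zeta)g'(\zeta)\,d\zeta$. $\asymp$ denotes two-sided comparability with positive constants independent of $g$. *)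

(* Defs.v *)
From HB Require Import structures.
From mathcomp Require Import all_boot all_order all_algebra.
From mathcomp Require Import complex.
From mathcomp Require Import all_classical all_reals all_analysis.

Set Implicit Arguments.
Unset Strict Implicit.
Unset Printing Implicit Defensive.

Import Order.TTheory GRing.Theory Num.Theory.
Import numFieldTopology.Exports numFieldNormedType.Exports.

Local Open Scope classical_set_scope.
Local Open Scope ring_scope.
Local Open Scope complex_scope.

Section HardySpaces.
Context {R : realType}.
Local Notation mu := (@lebesgue_measure R).
(* MathComp-Analysis puts the topology and the normed module structure of a
   numFieldType on its regular module; R[i]^o is convertible to R[i]. *)
Local Notation C := R[i]^o.

(* The norm of R[i] takes its values in R[i]; cabs z is the modulus as an
   element of R. *)
Definition cabs (z : C) : R := complex.Re `|z|.

Definition disc : set C := [set z | `|z| < 1].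

Definition power_series (a : nat -> C) (z0 z : C) : nat -> C :=
  series (fun n => a n * (z - z0) ^+ n).

Definition analytic_at (f : C -> C) (z0 : C) : Prop :=
  exists a : nat -> C,
    \forall z \near z0, power_series a z0 z n @[n --> \oo] --> f z.

(* Elements of H(D) are represented by total functions on R[i]; only their
   values on the open disc matter. *)
Definition analytic_disc (f : C -> C) : Prop :=
  forall z, disc z -> analytic_at f z.

Definition circle_point (r t : R) : C := (r * cos t) +i* (r * sin t).

(* M_2(r, f) = ((2 pi)^-1 int_0^{2 pi} |f(r e^{it})|^2 dt)^{1/2} *)
Definition M2 (r : R) (f : C -> C) : \bar R :=
  ((((2 * pi)^-1)%:E *
    \int[mu]_(t in `[0%R, (2 * pi)%R]) (cabs (f (circle_point r t)) ^+ 2)%:E)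
   `^ (2^-1))%E.

Definition H2norm (f : C -> C) : \bar R :=
  ereal_sup [set M2 r f | r in `]0%R, 1%R[].

Definition H2 (f : C -> C) : Prop :=
  analytic_disc f /\ (H2norm f < +oo)%E.

Definition Hoonorm (f : C -> C) : \bar R :=
  ereal_sup [set (cabs (f z))%:E | z in disc].

Definition Hoo (f : C -> C) : Prop :=
  analytic_disc f /\ (Hoonorm f < +oo)%E.

(* The integral is taken along the segment zeta = t z, 0 <= t <= 1, and
   computed separately on real and imaginary parts. *)
Definition Tg (g f : C -> C) (z : C) : C :=
  let F t := f (t%:C * z) * derive1 g (t%:C * z) * z in
  (\int[mu]_(t in `[0, 1]) complex.Re (F t)) +i*
  (\int[mu]_(t in `[0, 1]) complex.Im (F t)).

Definition bounded_H2_Hoo (A : (C -> C) -> C -> C) : Prop :=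
  exists M : R, forall f, H2 f ->
    Hoo (A f) /\ (Hoonorm (A f) <= M%:E * H2norm f)%E.

Definition compact_H2_Hoo (A : (C -> C) -> C -> C) : Prop :=
  (forall f, H2 f -> Hoo (A f)) /\
  forall f_ : nat -> C -> C,
    (exists M : R, forall n, H2 (f_ n) /\ (H2norm (f_ n) <= M%:E)%E) ->
    exists (s : nat -> nat) (h : C -> C),
      [/\ {homo s : m n / (m < n)%N}, Hoo h &
          Hoonorm (fun z => A (f_ (s n)) z - h z) @[n --> \oo] --> 0%E].

Definition opnorm_H2_Hoo (A : (C -> C) -> C -> C) : \bar R :=
  ereal_sup [set Hoonorm (A f) | f in [set f | H2 f /\ (H2norm f <= 1)%E]].

(* Computed in the extended reals; it is meaningful for ghat >= 0, where every
   term is nonnegative and a divergent inner sum counts as +oo. *)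
Definition hilbert_sum (ghat : nat -> R) : \bar R :=
  (\sum_(0 <= k <oo)
    (\sum_(0 <= n <oo) (n.+1%:R * ghat n.+1 / (n + k + 1)%:R)%:E) ^+ 2)%E.

Definition maclaurin (g : C -> C) (ghat : nat -> R) : Prop :=
  forall z, disc z ->
    power_series (fun n => (ghat n)%:C) 0 z n @[n --> \oo] --> g z.

End HardySpaces.

(* Main.v *)
(* If [f = sum_k a_k z^k] and [g' = sum_l b_l z^l] with [b_l = (l+1) ghat(l+1)],
   then [T_g f = sum_k a_k sum_l b_l z^(k+l+1) / (k+l+1)].  Putting
   [S_k = sum_l b_l / (k+l+1)], this gives [|T_g f| <= sum_k |a_k| S_k] in the
   disc, and since [b_l >= 0] the bound is attained in the limit [z -> 1] for
   nonnegative [a_k].  As the norm of [f] in H^2 is the l^2 norm of [a], the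
   norm of [T_g] is exactly the l^2 norm of [S]: both constants are 1.  If it is
   finite, the tails of [S] are small, so that coefficientwise convergence of a
   bounded sequence of H^2 implies uniform convergence of its image; hence
   compactness, by extraction of a coefficientwise convergent subsequence.

   Functions of H^2 are only given as locally power series.  That such an [f] is
   the sum of its Maclaurin series in the whole disc is proved without contour
   integrals: by compactness the Taylor coefficients of [f] at the points of
   [|z| <= rho] satisfy a uniform bound [|f^(j)(z) / j!| <= M d^-j]; on a circle
   [|z| = s] where the Maclaurin series represents [f], Parseval's identity turns
   it into [|a_m| C(m, j) s^(m-j) <= M d^-j], and summing over [j] the Maclaurin
   series converges for [|z| < s + d/2].  Each step gains a fixed amount. *)

Require Import Defs.
From mathcomp Require Import all_boot all_order all_algebra.
From mathcomp Require Import complex.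
From mathcomp Require Import ring lra.
From mathcomp Require Import all_classical all_reals all_analysis measurable_realfun.

Set Implicit Arguments.
Unset Strict Implicit.
Unset Printing Implicit Defensive.

Import Order.TTheory GRing.Theory Num.Theory.
Import numFieldTopology.Exports numFieldNormedType.Exports.

Local Open Scope classical_set_scope.
Local Open Scope ring_scope.
Local Open Scope complex_scope.

(** * Modulus and convergence in R[i] *)

Section Modulus.
Context {R : realType}.
Local Notation C := R[i]^o.
Implicit Types (z w : C) (x : R).

Lemma normc_cabs z : `|z| = (cabs z)%:C.
Proof. by rewrite /cabs normc_def. Qed.

Lemma cabs_ge0 z : 0 <= cabs z.
Proof. by rewrite -ler0c -normc_cabs. Qed.

Lemma cabsM z w : cabs (z * w) = cabs z * cabs w.
Proof. by apply: (@complexI R); rewrite rmorphM -!normc_cabs normrM. Qed.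

Lemma cabsD z w : cabs (z + w) <= cabs z + cabs w.
Proof. by rewrite -lecR rmorphD -!normc_cabs ler_normD. Qed.

Lemma cabsN z : cabs (- z) = cabs z.
Proof. by rewrite /cabs normrN. Qed.

Lemma cabsB z w : cabs (z - w) <= cabs z + cabs w.
Proof. by rewrite -(cabsN w) cabsD. Qed.

Lemma cabsC z w : cabs (z - w) = cabs (w - z).
Proof. by rewrite -cabsN opprB. Qed.

Lemma cabsX z n : cabs (z ^+ n) = cabs z ^+ n.
Proof. by apply: (@complexI R); rewrite rmorphXn -!normc_cabs normrX. Qed.

Lemma cabs_real x : cabs (x%:C : C) = `|x|.
Proof. by rewrite /cabs normc_def /= expr0n /= addr0 sqrtr_sqr. Qed.

Lemma cabs0 : cabs (0 : C) = 0.
Proof. by rewrite /cabs normr0. Qed.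

Lemma cabs1 : cabs (1 : C) = 1.
Proof. by rewrite /cabs normr1. Qed.

Lemma cabs_eq0 z : (cabs z == 0) = (z == 0).
Proof.
by rewrite -(normr_eq0 z) normc_cabs -(inj_eq (@complexI R)).
Qed.

Lemma cabs_nat n : cabs (n%:R : C) = n%:R.
Proof. by rewrite -(rmorph_nat (real_complex R)) cabs_real ger0_norm. Qed.

Lemma cabsV z : cabs (z^-1) = (cabs z)^-1.
Proof. by apply: (@complexI R); rewrite fmorphV -!normc_cabs normfV. Qed.

Lemma cabs_sum (I : Type) (s : seq I) (P : pred I) (F : I -> C) :
  cabs (\sum_(i <- s | P i) F i) <= \sum_(i <- s | P i) cabs (F i).
Proof.
elim/big_rec2: _ => [|i y x _ xy]; first by rewrite cabs0.
by rewrite (le_trans (cabsD _ _))// lerD2l.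
Qed.

Lemma cabs_sqr z : cabs z ^+ 2 = complex.Re z ^+ 2 + complex.Im z ^+ 2.
Proof.
by apply: (@complexI R); rewrite add_Re2_Im2 normc_cabs rmorphXn.
Qed.

Lemma ler_Re_cabs z : `|complex.Re z| <= cabs z.
Proof. by rewrite -lecR -normc_cabs normc_ge_Re. Qed.

Lemma ler_Im_cabs z : `|complex.Im z| <= cabs z.
Proof.
rewrite -(ler_pXn2r (ltn0Sn 1)) ?nnegrE ?cabs_ge0//.
by rewrite cabs_sqr real_normK ?num_real// lerDr sqr_ge0.
Qed.

Lemma cabs_le_ReIm z : cabs z <= `|complex.Re z| + `|complex.Im z|.
Proof.
rewrite -(ler_pXn2r (ltn0Sn 1)) ?nnegrE ?cabs_ge0 ?addr_ge0//.
rewrite cabs_sqr sqrrD !real_normK ?num_real// -addrA lerD2l lerDr.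
by rewrite mulrn_wge0 ?mulr_ge0.
Qed.

Lemma disc_cabs z : disc z <-> cabs z < 1.
Proof. by rewrite /disc /= normc_cabs -(ltcR (cabs z)). Qed.

(** The norm of [C] takes values in [R[i]]; this bridge turns limits in [C] into limits of real
    sequences, where order and squeeze arguments are available. *)
Lemma cvg_cabsP (T : Type) (F : set_system T) {FF : Filter F} (u : T -> C) z :
  u x @[x --> F] --> z <-> cabs (u x - z) @[x --> F] --> (0 : R).
Proof.
split=> [/cvgrPdist_lt h|/cvgrPdist_lt h]; apply/cvgrPdist_lt => e e0.
  have := h e%:C; rewrite ltcR => /(_ e0).
  apply: filterS => x; rewrite normc_cabs ltcR cabsC sub0r normrN.
  by rewrite ger0_norm ?cabs_ge0.
(* A positive element of [R[i]] is real, so the tolerance [e] is the image of its real part. *)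
move: (e0); rewrite lt_def => /andP[_ /ger0_real/RRe_real eE].
move: e0; rewrite -eE ltcR => e0.
have := h _ e0; apply: filterS => x; rewrite normc_cabs ltcR.
by rewrite sub0r normrN ger0_norm ?cabs_ge0// cabsC.
Qed.

Lemma cvg_complexP (T : Type) (F : set_system T) {FF : Filter F} (u : T -> C) z :
  u x @[x --> F] --> z <->
  (complex.Re (u x) @[x --> F] --> complex.Re z) /\
  (complex.Im (u x) @[x --> F] --> complex.Im z).
Proof.
split=> [/cvg_cabsP/cvgrPdist_lt h|[/cvgrPdist_lt h1 /cvgrPdist_lt h2]].
  split; apply/cvgrPdist_lt => e /h; apply: filterS => x;
    rewrite sub0r normrN (ger0_norm (cabs_ge0 _)); apply: le_lt_trans;
    rewrite cabsC.
    by rewrite -raddfB/=; exact: ler_Re_cabs.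
  by rewrite -raddfB/=; exact: ler_Im_cabs.
apply/cvg_cabsP/cvgrPdist_lt => e e0.
have e2 : 0 < e / 2 by rewrite divr_gt0.
near=> x; rewrite sub0r normrN (ger0_norm (cabs_ge0 _)) cabsC.
rewrite (le_lt_trans (cabs_le_ReIm _))// (splitr e) !raddfB/=.
by rewrite ltrD//; near: x; [exact: h1|exact: h2].
Unshelve. all: by end_near. Qed.

(** Arithmetic of limits in [C] is reduced to that of [R] through real and imaginary parts, here and
    for products and differences below. *)
Lemma cvgcD (T : Type) (F : set_system T) {FF : Filter F} (u v : T -> C) z w :
  u x @[x --> F] --> z -> v x @[x --> F] --> w ->
  u x + v x @[x --> F] --> (z + w : C).
Proof.
move=> /cvg_complexP[u1 u2] /cvg_complexP[v1 v2]; apply/cvg_complexP.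
have ReD (a b : C) : complex.Re (a + b) = complex.Re a + complex.Re b.
  by rewrite raddfD.
have ImD (a b : C) : complex.Im (a + b) = complex.Im a + complex.Im b.
  by rewrite raddfD.
rewrite ReD ImD; split.
  by under eq_cvg do rewrite ReD; exact: cvgD.
by under eq_cvg do rewrite ImD; exact: cvgD.
Qed.

Lemma cvgcM (T : Type) (F : set_system T) {FF : Filter F} (u v : T -> C) z w :
  u x @[x --> F] --> z -> v x @[x --> F] --> w ->
  u x * v x @[x --> F] --> (z * w : C).
Proof.
move=> /cvg_complexP[u1 u2] /cvg_complexP[v1 v2]; apply/cvg_complexP.
have ReM (a b : C) : complex.Re (a * b) =
    complex.Re a * complex.Re b - complex.Im a * complex.Im b.
  by case: a b => [? ?] [? ?].
have ImM (a b : C) : complex.Im (a * b) =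
    complex.Re a * complex.Im b + complex.Im a * complex.Re b.
  by case: a b => [? ?] [? ?].
rewrite ReM ImM; split.
  by under eq_cvg do rewrite ReM; apply: cvgB; exact: cvgM.
by under eq_cvg do rewrite ImM; apply: cvgD; exact: cvgM.
Qed.

Lemma cvgcZ (T : Type) (F : set_system T) {FF : Filter F} (u : T -> C) c z :
  u x @[x --> F] --> z -> c * u x @[x --> F] --> (c * z : C).
Proof. by apply: cvgcM; exact: cvg_cst. Qed.

Lemma cvgcB (T : Type) (F : set_system T) {FF : Filter F} (u v : T -> C) z w :
  u x @[x --> F] --> z -> v x @[x --> F] --> w ->
  u x - v x @[x --> F] --> (z - w : C).
Proof.
move=> /cvg_complexP[u1 u2] /cvg_complexP[v1 v2]; apply/cvg_complexP.
have ReB (a b : C) : complex.Re (a - b) = complex.Re a - complex.Re b.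
  by rewrite raddfB.
have ImB (a b : C) : complex.Im (a - b) = complex.Im a - complex.Im b.
  by rewrite raddfB.
rewrite ReB ImB; split.
  by under eq_cvg do rewrite ReB; exact: cvgB.
by under eq_cvg do rewrite ImB; exact: cvgB.
Qed.

Lemma cvgcX (T : Type) (F : set_system T) {FF : Filter F} (u : T -> C) z n :
  u x @[x --> F] --> z -> u x ^+ n @[x --> F] --> (z ^+ n : C).
Proof.
move=> uz; elim: n => [|n IH].
  by rewrite expr0; under eq_fun do rewrite expr0; exact: cvg_cst.
have -> : (fun y => u y ^+ n.+1) = (fun y => u y * u y ^+ n).
  by apply/funext => y; rewrite exprS.
by rewrite exprS; exact: (cvgcM uz IH).
Qed.

Lemma cvgc_sum (I T : Type) (F : set_system T) {FF : Filter F} (s : seq I)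
    (u : I -> T -> C) (l : I -> C) :
  (forall i, u i x @[x --> F] --> l i) ->
  (\sum_(i <- s) u i x) @[x --> F] --> (\sum_(i <- s) l i : C).
Proof.
move=> ul; elim: s => [|i s IH].
  by rewrite big_nil; under eq_fun do rewrite big_nil; exact: cvg_cst.
rewrite big_cons; under eq_fun do rewrite big_cons.
exact: (cvgcD (ul i) IH).
Qed.

End Modulus.

(** * Power series *)

Section GeometricSeries.
Context {R : realType}.
Local Notation C := R[i]^o.
Implicit Types (u : nat -> C) (l : C) (K q : R).

Lemma cvg_sumr (I T : Type) (F : set_system T) {FF : Filter F} (s : seq I)
    (u : I -> T -> R) (l : I -> R) :
  (forall i, u i x @[x --> F] --> l i) ->
  (\sum_(i <- s) u i x) @[x --> F] --> \sum_(i <- s) l i.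
Proof. by move=> ul; apply: cvg_big => //; exact: add_continuous. Qed.

Lemma cvg_cabs (T : Type) (F : set_system T) {FF : Filter F} (u : T -> C) l :
  u x @[x --> F] --> l -> cabs (u x) @[x --> F] --> cabs l.
Proof.
move=> /cvg_cabsP/cvgrPdist_lt h; apply/cvgrPdist_lt => e /h.
apply: filterS => x; rewrite sub0r normrN (ger0_norm (cabs_ge0 _)).
apply: le_lt_trans.
have := cabsD (u x - l) l; have := cabsD (l - u x) (u x).
by rewrite !subrK (cabsC l) ler_norml => *; apply/andP; split; lra.
Qed.

Lemma cabs_le_lim (T : Type) (F : set_system T) {FF : ProperFilter F}
    (u : T -> C) l K :
  u x @[x --> F] --> l -> (\forall x \near F, cabs (u x) <= K) -> cabs l <= K.
Proof. by move=> /cvg_cabs /cvgr_to_le; apply. Qed.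

Lemma cvg_cabs_le (u : nat -> C) l (e : nat -> R) :
  (forall n, cabs (l - u n) <= e n) -> e n @[n --> \oo] --> 0 ->
  u n @[n --> \oo] --> l.
Proof.
move=> h e0; apply/cvg_cabsP; apply: (squeeze_cvgr _ (cvg_cst 0) e0).
by apply: nearW => n; rewrite cabs_ge0 cabsC h.
Qed.

Lemma series_bounded u l : series u n @[n --> \oo] --> l ->
  exists K, forall n, cabs (u n) <= K.
Proof.
move=> ul; have u0 : u n @[n --> \oo] --> (0 : C).
  by apply: cvg_series_cvg_0; apply/cvg_ex; exists l.
have [M [_ /(_ (M + 1))]] := cvg_seq_bounded (cvgP _ (cvg_cabs u0)).
rewrite ltrDl ltr01 => /(_ isT) h; exists (M + 1) => n.
by have /= := h n I; rewrite ger0_norm ?cabs_ge0.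
Qed.

Lemma geometric_sum_le q (m n : nat) : 0 <= q < 1 ->
  \sum_(m <= i < n) q ^+ i <= q ^+ m / (1 - q).
Proof.
move=> /andP[q0 q1]; have q1' : 0 < 1 - q by rewrite subr_gt0.
have [mn|nm] := leqP m n; last first.
  by rewrite big_geq ?(ltnW nm)// divr_ge0 ?exprn_ge0// ltW.
rewrite -(subnKC mn) geometric_partial_tail geometric_seriesE ?lt_eqF//=.
by rewrite ler_pM2r ?invr_gt0// ler_piMr ?exprn_ge0// gerBl exprn_ge0.
Qed.

Lemma cvg_geometric_tail K q : 0 <= q < 1 ->
  K * q ^+ n / (1 - q) @[n --> \oo] --> 0.
Proof.
move=> /andP[q0 q1]; rewrite -[X in _ --> X](mul0r ((1 - q)^-1)); apply: cvgMl.
rewrite -[X in _ --> X](mulr0 K); apply: cvgMr.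
by apply: cvg_expr; rewrite ger0_norm.
Qed.

Lemma series_geometric_dist u K q (m n : nat) : 0 <= q < 1 -> (m <= n)%N ->
  (forall i, cabs (u i) <= K * q ^+ i) ->
  cabs (series u n - series u m) <= K * q ^+ m / (1 - q).
Proof.
move=> q01 mn uK.
have K0 : 0 <= K by have := uK 0%N; rewrite expr0 mulr1; apply/le_trans/cabs_ge0.
rewrite sub_series_geq// (le_trans (cabs_sum _ _ _))//.
rewrite (le_trans (ler_sum _ (fun i _ => uK i)))// -mulr_sumr -mulrA.
by rewrite ler_wpM2l// geometric_sum_le.
Qed.

(** The tail bound depends on [K] and [q] only; this is the source of all uniform convergence later,
    on circles and on segments. *)
Lemma series_geometric_tail u K q l (m : nat) : 0 <= q < 1 ->
  (forall i, cabs (u i) <= K * q ^+ i) -> series u n @[n --> \oo] --> l ->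
  cabs (l - series u m) <= K * q ^+ m / (1 - q).
Proof.
move=> q01 uK ul.
have : series u n - series u m @[n --> \oo] --> l - series u m.
  exact: (cvgcB ul (cvg_cst (series u m))).
move/cabs_le_lim; apply; exists m => // n /= mn; exact: series_geometric_dist.
Qed.

(** Completeness is used in [R] alone: real and imaginary parts converge absolutely by comparison
    with the geometric series. *)
Lemma cvg_series_geometric u K q : 0 <= q < 1 ->
  (forall i, cabs (u i) <= K * q ^+ i) ->
  exists l, series u n @[n --> \oo] --> l.
Proof.
move=> q01 uK; have /andP[q0 q1] := q01.
have K0 : 0 <= K by have := uK 0%N; rewrite expr0 mulr1; apply/le_trans/cabs_ge0.
have aux (v : nat -> R) : (forall i, `|v i| <= cabs (u i)) -> cvgn (series v).
  move=> vu; apply: normed_cvg; apply: (@series_le_cvg _ _ (geometric K q)) => //.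
  - by move=> n; rewrite /= normr_ge0.
  - by move=> n; rewrite /= mulr_ge0 ?exprn_ge0.
  - by move=> n; rewrite (le_trans (vu n)).
  - by apply: is_cvg_geometric_series; rewrite ger0_norm.
have /cvg_ex[x hx] := aux (fun i => complex.Re (u i)) (fun i => ler_Re_cabs _).
have /cvg_ex[y hy] := aux (fun i => complex.Im (u i)) (fun i => ler_Im_cabs _).
exists (x +i* y); apply/cvg_complexP; split.
  by under eq_fun do rewrite /series/= raddf_sum.
by under eq_fun do rewrite /series/= raddf_sum.
Qed.

End GeometricSeries.

(** * Functions given by a power series on a disc *)

Section PowerSeries.
Context {R : realType}.
Local Notation C := R[i]^o.
Implicit Types (f : C -> C) (a b : nat -> C) (z w : C) (r s K : R).

(** The number [r] is only a lower bound for the radius of convergence, and the condition is void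
    for [r <= 0]. *)
Definition represents f z0 a r :=
  forall z, cabs (z - z0) < r -> power_series a z0 z n @[n --> \oo] --> f z.

Lemma power_series0 a z w : power_series a z w 0 = 0.
Proof. by rewrite /power_series /series/= big_geq. Qed.

Lemma power_seriesS a z w n :
  power_series a z w n.+1 = power_series a z w n + a n * (w - z) ^+ n.
Proof. by rewrite /power_series /series/= big_nat_recr. Qed.

Lemma represents_le f z a r s : s <= r -> represents f z a r ->
  represents f z a s.
Proof. by move=> sr fa w ws; apply: fa; exact: lt_le_trans sr. Qed.

(** The series converges at the point [z + s], and the terms of a convergent series are bounded. *)
Lemma represents_coef_bound f z a r s : represents f z a r -> 0 <= s < r ->
  exists K, forall n, cabs (a n) * s ^+ n <= K.
Proof.
move=> fa /andP[s0 sr]; have sz : cabs (z + s%:C - z) = s.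
  by rewrite addrAC subrr add0r cabs_real ger0_norm.
have [] := series_bounded (fa (z + s%:C) _); first by rewrite sz.
by move=> K hK; exists K => n; have := hK n; rewrite cabsM cabsX sz.
Qed.

Lemma coef_bound_term a s K w : 0 < s ->
  (forall n, cabs (a n) * s ^+ n <= K) ->
  forall n, cabs (a n * w ^+ n) <= K * (cabs w / s) ^+ n.
Proof.
move=> s0 aK n; rewrite cabsM cabsX expr_div_n mulrA mulrAC.
by rewrite ler_wpM2r ?exprn_ge0 ?cabs_ge0// ler_pdivlMr ?exprn_gt0.
Qed.

Lemma coef_bound_ge0 a s K : (forall n, cabs (a n) * s ^+ n <= K) -> 0 <= K.
Proof. by move=> /(_ 0%N); rewrite expr0 mulr1; apply/le_trans/cabs_ge0. Qed.

Lemma coef_bound_represents a z s K : 0 < s ->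
  (forall n, cabs (a n) * s ^+ n <= K) -> exists f, represents f z a s.
Proof.
move=> s0 aK.
have : forall w : C, exists l : C, cabs (w - z) < s ->
    power_series a z w n @[n --> \oo] --> l.
  (* Outside the disc the sum function takes the default value 0. *)
  move=> w; have [ws|] := ltP (cabs (w - z)) s; last by exists 0.
  have [|l hl] := cvg_series_geometric _ (coef_bound_term (w - z) s0 aK).
    by rewrite divr_ge0 ?cabs_ge0 ?ltW//= ltr_pdivrMr// mul1r.
  by exists l.
by move=> /choice[f hf]; exists f => w; exact: hf.
Qed.

Lemma represents_tail f z a r s K w m : represents f z a r -> s <= r ->
  (forall n, cabs (a n) * s ^+ n <= K) -> cabs (w - z) < s ->
  cabs (f w - power_series a z w m) <=
  K * (cabs (w - z) / s) ^+ m / (1 - cabs (w - z) / s).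
Proof.
move=> fa sr aK ws; have s0 : 0 < s by apply: le_lt_trans ws; exact: cabs_ge0.
apply: series_geometric_tail.
- by rewrite divr_ge0 ?cabs_ge0 ?ltW//= ltr_pdivrMr// mul1r.
- exact: coef_bound_term.
- by apply: fa; exact: lt_le_trans sr.
Qed.

End PowerSeries.

(** * Re-expansion about another centre, and the derivative *)

Section Reexpansion.
Context {R : realType}.
Local Notation C := R[i]^o.
Implicit Types (f : C -> C) (a b : nat -> C) (z w h : C) (r s t x K : R).

Lemma binomial_term_le x t (m j : nat) : 0 <= x -> 0 <= t ->
  x ^+ (m - j) * t ^+ j *+ 'C(m, j) <= (x + t) ^+ m.
Proof.
move=> x0 t0; have [jm|mj] := leqP j m; last first.
  by rewrite bin_small// mulr0n exprn_ge0// addr_ge0.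
rewrite exprDn (bigD1 (Ordinal (jm : (j < m.+1)%N)))//= lerDl sumr_ge0// => i _.
by rewrite mulrn_wge0// mulr_ge0 ?exprn_ge0.
Qed.

(** For [m < J] the truncated sum already contains the whole binomial expansion; otherwise the
    omitted terms are part of the expansion of the power of [cabs w + cabs h]. *)
Lemma cabs_binomial_remainder w h (m J : nat) :
  cabs ((w + h) ^+ m - \sum_(0 <= j < J) w ^+ (m - j) * h ^+ j *+ 'C(m, j)) <=
  if (J <= m)%N then (cabs w + cabs h) ^+ m else 0.
Proof.
have wh : (w + h) ^+ m =
    \sum_(0 <= j < m.+1) w ^+ (m - j) * h ^+ j *+ 'C(m, j).
  by rewrite exprDn big_mkord.
case: ifPn => [Jm|]; last first.
  rewrite -ltnNge => mJ; rewrite wh (big_cat_nat (leq0n m.+1) mJ)/=.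
  rewrite [in X in _ - (_ + X)]big_nat [X in _ - (_ + X)]big1.
    by rewrite addr0 subrr cabs0.
  by move=> j /andP[mj _]; rewrite bin_small// mulr0n.
rewrite wh (big_cat_nat (leq0n J) (leqW Jm))/= addrAC subrr add0r.
rewrite (le_trans (cabs_sum _ _ _))//.
have -> : (cabs w + cabs h) ^+ m =
    \sum_(0 <= j < m.+1) cabs w ^+ (m - j) * cabs h ^+ j *+ 'C(m, j).
  by rewrite exprDn big_mkord.
rewrite (big_cat_nat (leq0n J) (leqW Jm))/=.
under eq_bigr do rewrite -mulr_natr !cabsM !cabsX cabs_nat mulr_natr.
by rewrite lerDr sumr_ge0// => j _; rewrite mulrn_wge0// mulr_ge0 ?exprn_ge0 ?cabs_ge0.
Qed.

Lemma reexpand_term_le a s K w t (j m : nat) : 0 < s -> 0 <= t ->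
  (forall n, cabs (a n) * s ^+ n <= K) ->
  cabs (a m * w ^+ (m - j) *+ 'C(m, j)) * t ^+ j <= K * ((cabs w + t) / s) ^+ m.
Proof.
move=> s0 t0 aK.
rewrite -mulr_natr !cabsM cabsX cabs_nat -!mulrA.
apply: (@le_trans _ _ (cabs (a m) * (cabs w + t) ^+ m)).
  rewrite ler_wpM2l ?cabs_ge0// (mulrC _%:R) mulrA mulr_natr.
  by rewrite binomial_term_le ?cabs_ge0.
rewrite expr_div_n mulrA mulrAC ler_wpM2r ?exprn_ge0 ?addr_ge0 ?cabs_ge0//.
by rewrite ler_pdivlMr ?exprn_gt0.
Qed.

(** The series for [bj], scaled by [t ^+ j], is dominated by a geometric series whose ratio does not
    depend on [j]. The bound is therefore uniform in [j], and in [w] as long as [cabs w + t] stays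
    away from [s]. *)
Lemma reexpand_coef_bound a s K w t (j : nat) (bj : C) : 0 <= t ->
  cabs w + t < s -> (forall n, cabs (a n) * s ^+ n <= K) ->
  series (fun m => a m * w ^+ (m - j) *+ 'C(m, j)) n @[n --> \oo] --> bj ->
  cabs bj * t ^+ j <= K / (1 - (cabs w + t) / s).
Proof.
move=> t0 wts aK hb.
have wt0 : 0 <= cabs w + t by rewrite addr_ge0 ?cabs_ge0.
have s0 : 0 < s by exact: le_lt_trans wts.
have q01 : 0 <= (cabs w + t) / s < 1.
  by rewrite divr_ge0 ?(ltW s0)//= ltr_pdivrMr ?mul1r.
pose v m : C := (t ^+ j)%:C * (a m * w ^+ (m - j) *+ 'C(m, j)).
have hv : series v n @[n --> \oo] --> ((t ^+ j)%:C * bj : C).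
  rewrite (_ : series v = (fun n => ((t ^+ j)%:C : C) *
      series (fun m => a m * w ^+ (m - j) *+ 'C(m, j)) n)).
    exact: cvgcZ.
  by apply/funext => n; rewrite /series/= mulr_sumr.
have vK i : cabs (v i) <= K * ((cabs w + t) / s) ^+ i.
  rewrite /v mulrC cabsM cabs_real normrX ger0_norm//.
  exact: reexpand_term_le.
have := series_geometric_tail 0 q01 vK hv.
rewrite expr0 mulr1 /series/= big_geq// subr0 (mulrC _ bj) cabsM cabs_real.
by rewrite normrX ger0_norm.
Qed.

(** No double series is rearranged. For each [J], the error of the new expansion after [J] terms is
    itself the sum over [m] of [a m] times a binomial remainder; these terms vanish for [m < J] and
    are at most [K * q ^+ m], so the error is a geometric tail. *)
Lemma reexpand f z0 a r z1 : represents f z0 a r -> cabs (z1 - z0) < r ->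
  exists b, represents f z1 b (r - cabs (z1 - z0)) /\
    forall j, series (fun m => a m * (z1 - z0) ^+ (m - j) *+ 'C(m, j)) n
      @[n --> \oo] --> b j.
Proof.
move=> fa; set w := z1 - z0 => wr.
have cw := cabs_ge0 w.
have : forall j, exists bj : C,
    series (fun m => a m * w ^+ (m - j) *+ 'C(m, j)) n @[n --> \oo] --> bj.
  (* With these choices [cabs w + t < s < r]. *)
  move=> j; pose t := (r - cabs w) / 3; pose s := cabs w + 2 * t.
  have t0 : 0 < t by rewrite /t; lra.
  have s0 : 0 < s by rewrite /s; lra.
  have [|K aK] := represents_coef_bound (s := s) fa; first by rewrite /s /t; lra.
  apply: (@cvg_series_geometric _ _ (K / t ^+ j) ((cabs w + t) / s)).
    by rewrite divr_ge0 ?ler_pdivrMr ?ltr_pdivrMr//= /s; lra.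
  move=> i; rewrite mulrAC ler_pdivlMr ?exprn_gt0//.
  by apply: reexpand_term_le => //; exact: ltW.
move=> /choice[b hb]; exists b; split => // z zr; rewrite /power_series.
set h := z - z1; have ch := cabs_ge0 h.
have zE : z - z0 = w + h by rewrite /w /h [RHS]addrC addrA subrK.
(* The midpoint between [cabs w + cabs h] and [r]. *)
pose s := (r + cabs w + cabs h) / 2.
have rwh : cabs w + cabs h < r by move: zr; rewrite -/h; lra.
have s0 : 0 < s by rewrite /s; lra.
have [|K aK] := represents_coef_bound (s := s) fa; first by rewrite /s; lra.
have K0 := coef_bound_ge0 aK.
pose q := (cabs w + cabs h) / s.
have q01 : 0 <= q < 1.
  rewrite /q divr_ge0 ?addr_ge0 ?(ltW s0)//= ltr_pdivrMr// mul1r.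
  by rewrite /s; lra.
apply: (cvg_cabs_le _ (cvg_geometric_tail K q01)) => J.
pose u m := a m * ((w + h) ^+ m -
  \sum_(0 <= j < J) w ^+ (m - j) * h ^+ j *+ 'C(m, j)).
have uu : series u n @[n --> \oo] --> f z - series (fun j => b j * h ^+ j) J.
  rewrite (_ : series u = (fun n => power_series a z0 z n -
    \sum_(0 <= j < J)
      series (fun m => a m * w ^+ (m - j) *+ 'C(m, j)) n * h ^+ j)).
    apply: cvgcB; first by apply: fa; rewrite zE (le_lt_trans (cabsD _ _)).
    apply: (cvgc_sum (fun j => cvgcM (hb j) (cvg_cst (h ^+ j)))).
  apply/funext => n; rewrite /power_series /series/= zE.
  under [X in _ - X]eq_bigr do rewrite mulr_suml.
  rewrite exchange_big/= -sumrB; apply: eq_bigr => m _.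
  rewrite /u mulrBr mulr_sumr; congr (_ - _); apply: eq_bigr => j _.
  by rewrite mulrnAl mulrnAr mulrA.
have uK i : cabs (u i) <= K * q ^+ i.
  apply: (@le_trans _ _ (cabs (a i) * (cabs w + cabs h) ^+ i)).
    rewrite /u cabsM ler_wpM2l ?cabs_ge0//.
    rewrite (le_trans (cabs_binomial_remainder _ _ _ _))//.
    by case: ifP => // _; rewrite exprn_ge0 ?addr_ge0.
  rewrite /q expr_div_n mulrA mulrAC ler_wpM2r ?exprn_ge0 ?addr_ge0//.
  by rewrite ler_pdivlMr ?exprn_gt0.
(* The tail estimate is applied from index [J] on, the first [J] terms of [u] being zero. *)
have := series_geometric_tail J q01 uK uu.
rewrite (_ : series u J = 0) ?subr0//.
rewrite /series/= big_nat big1// => i /andP[_ iJ]; apply/eqP.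
rewrite -cabs_eq0 /u cabsM mulf_eq0; apply/orP; right.
have := cabs_binomial_remainder w h i J; rewrite leqNgt iJ/= => h0.
by rewrite eq_le h0 cabs_ge0.
Qed.

Lemma cabs_near z (e : R) : 0 < e -> \forall w \near z, cabs (w - z) < e.
Proof.
move=> e0; have : (id : C -> C) w @[w --> z] --> z by exact: cvg_id.
move=> /cvg_cabsP/cvgrPdist_lt/(_ e e0); apply: filterS => w.
by rewrite sub0r normrN ger0_norm ?cabs_ge0.
Qed.

Lemma represents_analytic_disc f a : represents f 0 a 1 -> analytic_disc f.
Proof.
move=> fa z /disc_cabs z1.
have [|b [fb _]] := reexpand (z1 := z) fa; first by rewrite subr0.
exists b; rewrite subr0 in fb.
have e0 : 0 < 1 - cabs z by rewrite subr_gt0.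
by apply: filterS (cabs_near z e0) => w; exact: fb.
Qed.

Lemma analytic_atP f z :
  analytic_at f z <-> exists a r, 0 < r /\ represents f z a r.
Proof.
split=> [[a /nbhs_ballP[e /= e0]] h|[a [r [r0 fa]]]]; last first.
  by exists a; apply: filterS (cabs_near z r0) => w; exact: fa.
move: (e0); rewrite lt_def => /andP[_ /ger0_real/RRe_real eE].
move: e0; rewrite -eE ltcR => e0.
exists a, (complex.Re e); split=> // w we; apply: h.
by rewrite -ball_normE /ball_/= normc_cabs -eE ltcR cabsC.
Qed.

(** The difference quotient minus [a 1] is the series remainder after two terms divided by [h],
    hence of order [h]. *)
Lemma represents_derive f z a r : 0 < r -> represents f z a r ->
  derive1 f z = a 1%N.
Proof.
move=> r0 fa; have r20 : 0 < r / 2 by rewrite divr_gt0.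
have [|K aK] := represents_coef_bound (s := r / 2) fa.
  by rewrite ltW//= gtr_pMr// invf_lt1// ltr1n.
have fz : f z = a 0%N.
  have : power_series a z z n @[n --> \oo] --> a 0%N.
    rewrite -(cvg_shiftn 1) /power_series /series/=.
    rewrite (_ : (fun n => _) = fun=> a 0%N); first exact: cvg_cst.
    apply/funext => n; rewrite addn1 big_nat_recl//= expr0 mulr1 subrr.
    by rewrite big1 ?addr0// => i _; rewrite expr0n/= mulr0.
  apply: cvg_unique => //; apply: fa.
  by rewrite subrr cabs0.
have K0 := coef_bound_ge0 aK.
rewrite /derive1; apply: cvg_lim => //.
apply/cvg_cabsP; apply/cvgrPdist_lt => e e0.
(* For [cabs h < r / 4] the tail bound with radius [r / 2] has denominator at least 1/2, so the
   remainder is at most [8 * K / r ^+ 2 * cabs h ^+ 2]; [K + 1] replaces [K] to make [M]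
   positive. *)
pose M := 8 * (K + 1) / r ^+ 2.
have M0 : 0 < M by rewrite divr_gt0 ?exprn_gt0// mulr_gt0//; lra.
have d0 : 0 < Num.min (r / 4) (e / M).
  by rewrite lt_min; apply/andP; split; apply: divr_gt0.
near=> h; have h0 : h != 0 by near: h; exact: nbhs_dnbhs_neq.
have : cabs h < Num.min (r / 4) (e / M).
  by near: h; apply: nbhs_dnbhs; under eq_fun do rewrite -[X in cabs X]subr0;
    exact: cabs_near.
rewrite lt_min => /andP[hr he].
have ch : 0 < cabs h by rewrite lt_def cabs_eq0 h0 cabs_ge0.
rewrite sub0r normrN ger0_norm ?cabs_ge0//.
have -> : h^-1 *: (f (h + z) - f z) - a 1%N =
    h^-1 * (f (h + z) - power_series a z (h + z) 2).
  rewrite /power_series /series/= !big_nat_recr//= big_geq// addrK.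
  rewrite add0r expr0 mulr1 expr1 fz -[_ *: _]/(_ * _).
  by rewrite opprD addrA [in RHS]mulrBr (mulrC (a _)) mulKf.
have hz : h + z - z = h by rewrite addrK.
have r2 : r / 2 <= r by lra.
have := @represents_tail _ f z a r (r / 2) K (h + z) 2 fa r2 aK.
rewrite hz cabsM cabsV => /(_ _)/le_trans H.
rewrite mulrC ltr_pdivrMr//.
apply: (@le_lt_trans _ _ (M * cabs h ^+ 2)); last first.
  by rewrite expr2 mulrA ltr_pM2r// mulrC -ltr_pdivlMr.
apply: H; first by lra.
rewrite ler_pdivrMr; last by rewrite subr_gt0 ltr_pdivrMr; lra.
rewrite expr_div_n.
have h1 : 2^-1 <= 1 - cabs h / (r / 2).
  by rewrite lerBrDr -lerBrDl ler_pdivrMr//; lra.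
have -> : K * (cabs h ^+ 2 / (r / 2) ^+ 2) = 4 * K / r ^+ 2 * cabs h ^+ 2.
  by field; lra.
apply: (@le_trans _ _ (M * cabs h ^+ 2 * 2^-1)); last first.
  by rewrite ler_wpM2l// mulr_ge0 ?exprn_ge0 ?ltW.
have -> : M * cabs h ^+ 2 * 2^-1 = 4 * (K + 1) / r ^+ 2 * cabs h ^+ 2.
  by rewrite /M; field; lra.
rewrite ler_wpM2r ?exprn_ge0 ?(ltW ch)//.
by rewrite ler_wpM2r ?invr_ge0 ?exprn_ge0 ?(ltW r0)//; lra.
Unshelve. all: by end_near. Qed.


End Reexpansion.

(** * Parseval's identity *)

Section RealIntegrals.
Context {R : realType}.
Local Notation mu := (@lebesgue_measure R).
Implicit Types (f F h : R -> R) (a b : R).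

Lemma continuous_integrable_segment f a b : continuous f ->
  mu.-integrable `[a, b] (EFin \o f).
Proof.
move=> cf; apply: continuous_compact_integrable; first exact: segment_compact.
exact: continuous_subspaceT.
Qed.

Lemma Rintegral_primitive f F a b : a < b -> continuous f ->
  (forall x : R, is_derive x (1 : R) F (f x)) ->
  \int[mu]_(x in `[a, b]) f x = F b - F a.
Proof.
move=> ab cf dF.
have cF : continuous F.
  move=> x; have [d _] := dF x.
  exact/differentiable_continuous/derivable1_diffP.
rewrite /Rintegral (continuous_FTC2 (F := F) ab)//.
- exact: continuous_subspaceT.
- split.
  + by move=> x _; have [] := dF x.
  + exact/cvg_at_right_filter/cF.
  + exact/cvg_at_left_filter/cF.
- by move=> x _; rewrite derive1E; have [_] := dF x.
Qed.

Lemma cvg_Rintegral_uniform (h_ : nat -> R -> R) h (e : nat -> R) a b :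
  a <= b -> (forall n, continuous (h_ n)) ->
  (forall n t, t \in `[a, b] -> `|h t - h_ n t| <= e n) ->
  e n @[n --> \oo] --> 0 ->
  mu.-integrable `[a, b] (EFin \o h) /\
  (\int[mu]_(t in `[a, b]) h_ n t) @[n --> \oo] --> \int[mu]_(t in `[a, b]) h t.
Proof.
move=> ab ch he e0.
have mab : measurable (`[a, b] : set R) by exact: measurable_itv.
have ih n : mu.-integrable `[a, b] (EFin \o h_ n).
  exact: continuous_integrable_segment.
have mh : measurable_fun `[a, b] h.
  apply: (@measurable_realfun.measurable_fun_cvg _ _ _ _ h_).
    by move=> n; have /integrableP[/measurable_EFinP] := ih n.
  move=> t tab; apply/cvgrPdist_lt => x x0.
  have /cvgrPdist_lt/(_ x x0) := e0; apply: filterS => n.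
  rewrite sub0r normrN => /(le_lt_trans (ler_norm _)).
  by apply: le_lt_trans; exact: he.
have icst (c : R) : mu.-integrable `[a, b] (EFin \o cst c).
  by apply: continuous_integrable_segment => t; exact: cvg_cst.
have ihh : mu.-integrable `[a, b] (EFin \o h).
  have ig : mu.-integrable `[a, b] (EFin \o (fun t => `|h_ 0%N t| + e 0%N)).
    apply: continuous_integrable_segment => t.
    by apply: cvgD; [apply: cvg_norm; exact: ch|exact: cvg_cst].
  apply: (le_integrable _ _ _ ig) => //; first exact/measurable_EFinP.
  move=> t tab; rewrite !abse_EFin lee_fin.
  apply: (le_trans _ (ler_norm _)).
  have := he 0%N t tab; have := ler_normD (h t - h_ 0%N t) (h_ 0%N t).
  by rewrite subrK; lra.
split=> //; apply/cvgrPdist_le => x x0.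
(* Adding 1 to the length keeps the divisor positive when [a = b]. *)
have ba : 0 < b - a + 1 by lra.
have /cvgrPdist_le/(_ (x / (b - a + 1))) := e0.
rewrite divr_gt0// => /(_ isT); apply: filterS => n.
rewrite sub0r normrN => ex; rewrite -RintegralB//.
have ihd : mu.-integrable `[a, b] (EFin \o (fun t => h t - h_ n t)).
  by apply: (integrableB _ ihh (ih n)).
rewrite (le_trans (le_normr_Rintegral _ _))//.
rewrite (@le_trans _ _ (\int[mu]_(t in `[a, b]) e n))//.
  apply: le_Rintegral => //; [exact: (integrable_norm ihd)|exact: icst|].
  by move=> t; exact: he.
rewrite Rintegral_cst//= lebesgue_measure_itv/= lte_fin.
have en0 : 0 <= e n.
  by apply: le_trans (he n a _); rewrite // in_itv/= lexx.
rewrite (ger0_norm en0) ler_pdivlMr// in ex.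
case: ifPn => [ab'|_]; last by rewrite mulr0 ltW.
rewrite -EFinB/=; apply: le_trans ex; rewrite ler_wpM2l//; lra.
Qed.

Lemma is_derive_mull (c x : R) : is_derive x (1 : R) ( *%R c) c.
Proof.
apply: (is_derive_eq (is_deriveZ c (is_derive_id x (1 : R)))).
by rewrite /GRing.scale/= mulr1.
Qed.

Lemma Rintegral_expr (n : nat) :
  \int[mu]_(t in `[0, 1]) t ^+ n = n.+1%:R^-1 :> R.
Proof.
have dF (x : R) :
    is_derive x (1 : R) (fun t : R => n.+1%:R^-1 * t ^+ n.+1) (x ^+ n).
  have d1 : is_derive x (1 : R) (fun t : R => t ^+ n.+1) (n.+1%:R * x ^+ n).
    elim: n => [|n IH].
      rewrite mulr1.
      by rewrite (_ : (fun t => _) = id); [exact: is_derive_id|exact/funext].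
    rewrite (_ : (fun t => _) = id * (fun t => t ^+ n.+1)); last first.
      by apply/funext => t; rewrite exprS.
    apply: (is_derive_eq (is_deriveM (is_derive_id _ _) IH)).
    by rewrite /GRing.scale/= exprS -[n.+2%:R]natr1 [n.+1%:R](_ : _ = n%:R + 1);
      [ring|rewrite natr1].
  apply: (is_derive_eq (is_derive1_comp (is_derive_mull _ _) d1)).
  by rewrite mulKf// pnatr_eq0.
rewrite (Rintegral_primitive ltr01 (@exprn_continuous _ n) dF).
by rewrite expr1n expr0n/= mulr0 mulr1 subr0.
Qed.

(** For [n > 0] the integrand has a primitive of period [2 * pi]. *)
Lemma Rintegral_trig (x y : R) (n : nat) : (0 < n)%N ->
  \int[mu]_(t in `[0, 2 * pi]) (x * cos (n%:R * t) - y * sin (n%:R * t)) = 0.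
Proof.
move=> n0.
have cc (c : R) : continuous (fun t : R => cos (c * t)).
  move=> t; apply: (@continuous_comp _ _ _ ( *%R c) cos).
    exact: mulrl_continuous.
  exact: continuous_cos.
have cs (c : R) : continuous (fun t : R => sin (c * t)).
  move=> t; apply: (@continuous_comp _ _ _ ( *%R c) sin).
    exact: mulrl_continuous.
  exact: continuous_sin.
have dF (t : R) : is_derive t (1 : R)
    (fun t => n%:R^-1 * (x * sin (n%:R * t) + y * cos (n%:R * t)))
    (x * cos (n%:R * t) - y * sin (n%:R * t)).
  have ds : is_derive t (1 : R) (fun t => x * sin (n%:R * t))
      (x * (cos (n%:R * t) * n%:R)).
    apply: (is_derive1_comp (is_derive_mull _ _)).
    exact: (is_derive1_comp (is_derive_sin _) (is_derive_mull _ _)).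
  have dc : is_derive t (1 : R) (fun t => y * cos (n%:R * t))
      (y * (- sin (n%:R * t) * n%:R)).
    apply: (is_derive1_comp (is_derive_mull _ _)).
    exact: (is_derive1_comp (is_derive_cos _) (is_derive_mull _ _)).
  apply: (is_derive_eq (is_derive1_comp (is_derive_mull _ _) (is_deriveD ds dc))).
  have : (n%:R : R) != 0 by rewrite pnatr_eq0 -lt0n.
  by move=> ?; field.
have cf : continuous (fun t : R => x * cos (n%:R * t) - y * sin (n%:R * t)).
  move=> t; apply: cvgB; apply: cvgM.
  - exact: cvg_cst.
  - exact: cc.
  - exact: cvg_cst.
  - exact: cs.
have pi2 : 0 < 2 * pi :> R by rewrite mulr_gt0// pi_gt0.
rewrite (Rintegral_primitive pi2 cf dF).
have -> : n%:R * (2 * pi) = 0 + pi *+ 2 *+ n :> R.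
  by rewrite add0r -[RHS]mulr_natl -(mulr_natl pi).
rewrite mulr0 (periodicn (@sinD2pi R)) (periodicn (@cosD2pi R)).
by rewrite subrr.
Qed.

End RealIntegrals.

(** * Orthogonality on circles and Parseval for power series *)

Section Parseval.
Context {R : realType}.
Local Notation C := R[i]^o.
Local Notation mu := (@lebesgue_measure R).
Implicit Types (f : C -> C) (a : nat -> C) (z w : C) (r s t K : R).

Lemma circle_pointX r t n :
  circle_point r t ^+ n = (r ^+ n * cos (n%:R * t)) +i* (r ^+ n * sin (n%:R * t)).
Proof.
elim: n => [|n IH]; first by rewrite !expr0 mul0r cos0 sin0 mulr1 mulr0.
rewrite exprS IH /circle_point -natr1 mulrDl mul1r cosD sinD exprS.
rewrite -[LHS]/(_ +i* _).
by congr (_ +i* _); ring.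
Qed.

Lemma cabs_circle_point r t : cabs (circle_point r t) = `|r|.
Proof.
apply/eqP; rewrite -(eqrXn2 (ltn0Sn 1)) ?cabs_ge0// cabs_sqr/=.
by rewrite !exprMn -mulrDr cos2Dsin2 mulr1 real_normK ?num_real.
Qed.

Lemma continuous_circle_point r : continuous (circle_point r : R -> C).
Proof.
move=> t; apply/cvg_complexP; split => /=.
  by apply: cvgM; [exact: cvg_cst|exact: continuous_cos].
by apply: cvgM; [exact: cvg_cst|exact: continuous_sin].
Qed.

Lemma cvg_power_series (T : Type) (F : set_system T) {FF : Filter F}
    (u : T -> C) a z w n :
  u x @[x --> F] --> w ->
  power_series a z (u x) n @[x --> F] --> power_series a z w n.
Proof.
move=> uw; apply: cvgc_sum => i.
have uz : u y - z @[y --> F] --> (w - z : C) by exact: (cvgcB uw (cvg_cst z)).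
exact: (cvgcZ (c := a i) (cvgcX (n := i) uz)).
Qed.

Lemma cabs_sqrD z w : cabs (z + w) ^+ 2 = cabs z ^+ 2 + cabs w ^+ 2 +
  2 * (complex.Re z * complex.Re w + complex.Im z * complex.Im w).
Proof. by rewrite !cabs_sqr; case: z w => [x y] [u v] /=; ring. Qed.

(** The integrand is the real part of [e n t] times the conjugate of [e m t]. By the formulas for
    the difference of angles it is a trigonometric expression of the single frequency [m - n]. *)
Lemma Rintegral_orthogonal a r (n m : nat) : (n < m)%N ->
  let e k t := a k * circle_point r t ^+ k in
  continuous (fun t => complex.Re (e n t) * complex.Re (e m t) +
                       complex.Im (e n t) * complex.Im (e m t)) /\
  \int[mu]_(t in `[0, 2 * pi]) (complex.Re (e n t) * complex.Re (e m t) +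
                       complex.Im (e n t) * complex.Im (e m t)) = 0.
Proof.
move=> nm e; split.
  have ce k t : e k x @[x --> t] --> e k t.
    exact: (cvgcZ (cvgcX (n := k) (continuous_circle_point (x := t)))).
  move=> t; have /cvg_complexP[n1 n2] := ce n t.
  have /cvg_complexP[m1 m2] := ce m t.
  by apply: cvgD; exact: cvgM.
set p := complex.Re (a n); set q := complex.Im (a n).
set c := complex.Re (a m); set d := complex.Im (a m).
rewrite -[RHS](@Rintegral_trig _ (r ^+ n * r ^+ m * (p * c + q * d))
  (r ^+ n * r ^+ m * (p * d - q * c)) (m - n)) ?subn_gt0//.
apply: eq_Rintegral => t _; rewrite /e !circle_pointX.
rewrite natrB ?(ltnW nm)// mulrBl cosB sinB.
rewrite /p /q /c /d; case: (a n) => x y; case: (a m) => u v /=.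
by ring.
Qed.

Lemma power_series_parseval a r n :
  let P t := power_series a 0 (circle_point r t) n in
  continuous (fun t => cabs (P t) ^+ 2) /\
  \int[mu]_(t in `[0, 2 * pi]) cabs (P t) ^+ 2 =
  2 * pi * \sum_(0 <= k < n) (cabs (a k) * `|r| ^+ k) ^+ 2.
Proof.
pose P n t := power_series a 0 (circle_point r t) n.
have cP m : continuous (fun t => cabs (P m t) ^+ 2).
  have -> : (fun t => cabs (P m t) ^+ 2) = (fun t => cabs (P m t) * cabs (P m t)).
    by apply/funext => t; rewrite expr2.
  by move=> t; apply: cvgM; apply: cvg_cabs; apply: cvg_power_series;
    exact: continuous_circle_point.
split; first exact: (cP n).
rewrite -[LHS]/(\int[mu]_(t in `[0, 2 * pi]) cabs (P n t) ^+ 2).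
elim: n => [|n IH].
  rewrite big_geq// mulr0 (_ : (fun t => _) = cst 0).
    by rewrite Rintegral_cst// mul0r.
  apply/funext => t.
  by rewrite /P power_series0 cabs0 expr0n.
pose e k t := a k * circle_point r t ^+ k.
(* [D n] collects the cross terms created by adding the term of index [n] to [P n]; its integral
   vanishes by orthogonality. *)
pose D m t := \sum_(0 <= k < m) (complex.Re (e k t) * complex.Re (e n t) +
                       complex.Im (e k t) * complex.Im (e n t)).
have hD m : (m <= n)%N -> continuous (D m) /\
    \int[mu]_(t in `[0, 2 * pi]) D m t = 0.
  elim: m => [|m IHm] mn.
    rewrite (_ : D 0%N = cst 0); last by apply/funext => t; rewrite /D big_geq.
    by split; [move=> t; exact: cvg_cst|rewrite Rintegral_cst// mul0r].
  have [cD iD] := IHm (ltnW mn).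
  have [cO iO] := @Rintegral_orthogonal a r m n mn.
  rewrite (_ : D m.+1 = fun t => D m t + (complex.Re (e m t) * complex.Re (e n t) +
                       complex.Im (e m t) * complex.Im (e n t))); last first.
    by apply/funext => t; rewrite /D big_nat_recr.
  split; first by move=> t; apply: cvgD; [exact: cD|exact: cO].
  by rewrite RintegralD//; [rewrite iD iO addr0|exact: continuous_integrable_segment..].
have [cD iD] := hD n (leqnn n).
have PE t : cabs (P n.+1 t) ^+ 2 =
    cabs (P n t) ^+ 2 + ((cabs (a n) * `|r| ^+ n) ^+ 2 + 2 * D n t).
  rewrite /P power_seriesS cabs_sqrD -addrA subr0.
  rewrite cabsM cabsX cabs_circle_point; congr (_ + (_ + 2 * _)).
  rewrite /D /power_series /series/= !raddf_sum !mulr_suml -big_split.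
  by apply: eq_bigr => k _; rewrite subr0.
under eq_Rintegral do rewrite PE.
have cc : continuous (fun _ : R => (cabs (a n) * `|r| ^+ n) ^+ 2 : R).
  by move=> t; exact: cvg_cst.
have c2 : continuous (fun t => 2 * D n t).
  by move=> t; apply: cvgM; [exact: cvg_cst|exact: cD].
rewrite RintegralD//; last 2 first.
- exact: continuous_integrable_segment.
- apply: continuous_integrable_segment => t.
  by apply: cvgD; [exact: cc|exact: c2].
rewrite RintegralD//; [|exact: (@continuous_integrable_segment _ _ _ _ cc)
  |exact: (@continuous_integrable_segment _ _ _ _ c2)].
have -> : \int[mu]_(t in `[0, 2 * pi]) (2 * D n t) = 0.
  rewrite RintegralZl//; first by rewrite iD mulr0.
  exact: continuous_integrable_segment.
rewrite addr0 IH Rintegral_cst//= lebesgue_measure_itv/= lte_fin.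
by rewrite mulr_gt0 ?pi_gt0//= subr0 [in RHS]big_nat_recr//=; ring.
Qed.

Lemma represents_parseval f a (rho : R) r : represents f 0 a rho -> 0 < r < rho ->
  mu.-integrable `[0, 2 * pi]
    (EFin \o (fun t => cabs (f (circle_point r t)) ^+ 2)) /\
  2 * pi * \sum_(0 <= k < n) (cabs (a k) * r ^+ k) ^+ 2 @[n --> \oo] -->
  \int[mu]_(t in `[0, 2 * pi]) cabs (f (circle_point r t)) ^+ 2.
Proof.
move=> fa /andP[r0 rr]; pose s := (r + rho) / 2.
have [|K aK] := represents_coef_bound (s := s) fa; first by rewrite /s; lra.
have s0 : 0 < s by rewrite /s; lra.
pose q := r / s.
have q01 : 0 <= q < 1.
  by rewrite /q divr_ge0 ?(ltW r0) ?(ltW s0)//= ltr_pdivrMr// /s; lra.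
have /andP[q0 q1] := q01.
have K0 := coef_bound_ge0 aK.
pose P n t := power_series a 0 (circle_point r t) n.
pose e n := K * q ^+ n / (1 - q).
have e0 : e n @[n --> \oo] --> 0 := cvg_geometric_tail K q01.
have fP n t : cabs (f (circle_point r t) - P n t) <= e n.
  have sr : s <= rho by rewrite /s; lra.
  have := represents_tail n fa sr aK (w := circle_point r t).
  rewrite subr0 cabs_circle_point gtr0_norm//; apply.
  by rewrite /s; lra.
have f0 t : cabs (f (circle_point r t)) <= e 0%N.
  by have := fP 0%N t; rewrite /P power_series0 subr0.
have Pe n t : cabs (P n t) <= e 0%N.
  have bk k : cabs (a k * (circle_point r t - 0) ^+ k) <= K * q ^+ k.
    rewrite subr0; have := coef_bound_term (circle_point r t) s0 aK k.
    by rewrite cabs_circle_point gtr0_norm.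
  have := series_geometric_dist q01 (leq0n n) bk.
  rewrite -![series _ _]/(power_series a 0 (circle_point r t) _).
  by rewrite power_series0 subr0.
(* Factor the difference of squares: the difference of the moduli is at most [e n], and each modulus
   is at most [e 0]. *)
have [|n|n t _||ih cvgh] := @cvg_Rintegral_uniform _ (fun n t => cabs (P n t) ^+ 2)
  (fun t => cabs (f (circle_point r t)) ^+ 2) (fun n => e n * (2 * e 0%N)) 0 (2 * pi).
- by rewrite mulr_ge0 ?pi_ge0.
- exact: (power_series_parseval a r n).1.
- rewrite subr_sqr normrM ler_pM//.
    rewrite ler_norml; have := fP n t.
    have := cabsD (f (circle_point r t) - P n t) (P n t); rewrite subrK.
    have := cabsD (P n t - f (circle_point r t)) (f (circle_point r t)).
    by rewrite subrK (cabsC (P n t)) => *; apply/andP; split; lra.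
  rewrite ger0_norm ?addr_ge0 ?cabs_ge0//.
  by have := f0 t; have := Pe n t; lra.
- by rewrite -[X in _ --> X](mul0r (2 * e 0%N)); apply: cvgMl.
split => //; apply: cvg_trans cvgh; apply: near_eq_cvg; apply: nearW => n.
by rewrite (power_series_parseval a r n).2 ger0_norm ?(ltW r0).
Qed.

End Parseval.

(** * Locally analytic functions on the disc are power series *)

Section Continuation.
Context {R : realType}.
Local Notation C := R[i]^o.
Local Notation mu := (@lebesgue_measure R).
Implicit Types (f g h : C -> C) (a b : nat -> C) (z w : C).
Implicit Types (r s t d K M rho : R).

Lemma represents_shift f z a r : represents f z a r ->
  represents (fun w => f (z + w)) 0 a r.
Proof.
move=> fa w; rewrite subr0 => hr.
have := fa (z + w); rewrite addrAC subrr add0r => /(_ hr).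
by rewrite /power_series addrAC subrr add0r subr0.
Qed.

(** Each single term of Parseval's sum is at most the mean of the squared modulus of [f] over the
    circle, hence at most [M ^+ 2]. *)
Lemma cauchy_estimate f z a r s M : represents f z a r -> 0 < s < r ->
  (forall w, cabs (w - z) = s -> cabs (f w) <= M) ->
  forall n, cabs (a n) * s ^+ n <= M.
Proof.
move=> fa /andP[s0 sr] fM n.
have [|ih cv] := represents_parseval (r := s) (represents_shift fa).
  by rewrite s0.
have M0 : 0 <= M.
  apply: le_trans (fM (z + s%:C) _); first exact: cabs_ge0.
  by rewrite addrAC subrr add0r cabs_real ger0_norm ?(ltW s0).
have pi2 : 0 < 2 * pi :> R by rewrite mulr_gt0 ?pi_gt0.
rewrite -(ler_pXn2r (ltn0Sn 1)) ?nnegrE ?mulr_ge0 ?cabs_ge0 ?exprn_ge0 ?(ltW s0)//.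
rewrite -(ler_pM2l pi2).
apply: (@le_trans _ _ (\int[mu]_(t in `[0, 2 * pi])
    cabs (f (z + circle_point s t)) ^+ 2)).
  apply: (cvgr_to_ge cv); exists n.+1 => // N /= nN.
  rewrite ler_pM2l// big_mkord (bigD1 (Ordinal nN))//= lerDl sumr_ge0// => i _.
  by rewrite exprn_ge0// mulr_ge0 ?cabs_ge0 ?exprn_ge0 ?(ltW s0).
have -> : 2 * pi * M ^+ 2 = \int[mu]_(t in `[0, 2 * pi]) (M ^+ 2).
  by rewrite Rintegral_cst//= lebesgue_measure_itv/= lte_fin pi2/= subr0 mulrC.
apply: le_Rintegral => //.
  by apply: continuous_integrable_segment => t; exact: cvg_cst.
move=> t _; rewrite ler_pXn2r ?nnegrE ?cabs_ge0//; apply: fM.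
by rewrite addrAC subrr add0r cabs_circle_point gtr0_norm.
Qed.

Lemma represents_sub f g z a b r : represents f z a r -> represents g z b r ->
  represents (fun w => f w - g w) z (fun n => a n - b n) r.
Proof.
move=> fa gb w wr.
have -> : power_series (fun n => a n - b n) z w =
    (fun n => power_series a z w n - power_series b z w n).
  apply/funext => n; rewrite /power_series /series/= -sumrB.
  by apply: eq_bigr => i _; rewrite mulrBl.
exact: (cvgcB (fa w wr) (gb w wr)).
Qed.

(** Cauchy's estimate with [M = 0], applied to [f - g]. *)
Lemma represents_unique f g z a b r : 0 < r ->
  (forall w, cabs (w - z) < r -> f w = g w) ->
  represents f z a r -> represents g z b r -> a = b.
Proof.
move=> r0 fg fa gb; apply/funext => n.
have r2 : 0 < r / 2 < r by apply/andP; split; lra.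
have /andP[r20 r2r] := r2.
have := cauchy_estimate (represents_sub fa gb) r2 (M := 0).
move=> /(_ _ n); rewrite pmulr_lle0 ?exprn_gt0// => H.
apply/eqP; rewrite -subr_eq0 -cabs_eq0 eq_le cabs_ge0 andbT; apply: H => w wr.
by rewrite fg ?wr// subrr cabs0.
Qed.

Lemma analytic_uniform_radius f rho : analytic_disc f -> rho < 1 ->
  exists d M, 0 < d /\ forall z, cabs z <= rho ->
    exists b, represents f z b d /\ forall j, cabs (b j) * d ^+ j <= M.
Proof.
move=> af rho1.
(* A single [n] encodes both the radius and the bound, and both requirements weaken as [n] grows.
   Near-covering compactness of a square of [R * R], with [n] tending to infinity, then gives one
   [n] for all points. *)
pose P (n : nat) (p : R * R) := cabs (p.1 +i* p.2 : C) <= rho ->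
  exists b, represents f (p.1 +i* p.2) b n.+1%:R^-1 /\
    forall j, cabs (b j) * n.+1%:R^-1 ^+ j <= n%:R.
have /compact_near_coveringP/(_ _ \oo P) :=
  compact_setX (@segment_compact R (-1) 1) (@segment_compact R (-1) 1).
case.
  move=> [x y] _; pose z0 : C := x +i* y.
  have nearz e : 0 < e -> \forall p \near (x, y), cabs ((p.1 +i* p.2 : C) - z0) < e.
    move=> e0.
    have : (fun p : R * R => p.1 +i* p.2 : C) @ (x, y) --> z0.
      by apply/cvg_complexP; split=> /=; [exact: cvg_fst|exact: cvg_snd].
    move=> /cvg_cabsP/cvgrPdist_lt/(_ e e0); apply: filterS => p.
    by rewrite sub0r normrN ger0_norm ?cabs_ge0.
  (* Points of the square outside the open disc have a neighbourhood that misses [cabs z <= rho],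
     where [P] is void. *)
  have [z1|z1] := ltP (cabs z0) 1; last first.
    have e0 : 0 < 1 - rho by rewrite subr_gt0.
    exists ([set p | cabs ((p.1 +i* p.2 : C) - z0) < 1 - rho], setT).
      by split; [exact: nearz|exact: filterT].
    move=> [p n] [/= pz _] prho.
    have := cabsD (p.1 +i* p.2) (z0 - (p.1 +i* p.2)).
    by rewrite addrC subrK cabsC; lra.
  have /disc_cabs/af/analytic_atP[a [r [r0 fa]]] := z1.
  have r2 : 0 <= r / 2 < r by apply/andP; split; lra.
  have [K aK] := represents_coef_bound fa r2.
  have e0 : 0 < r / 4 by rewrite divr_gt0.
  (* From [8 / r <= n] the new radius is at most [r / 8], so together with [cabs (z - z0) < r / 4]
     it uses at most 3/4 of [r / 2]. The bound of [reexpand_coef_bound] is then at most [4 * K],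
     which [n] also exceeds. *)
  exists ([set p | cabs ((p.1 +i* p.2 : C) - z0) < r / 4],
          [set n | 8 / r + 4 * K <= n%:R /\ 8 / r <= n%:R ]).
    split; first exact: nearz.
    by apply: filterI; exact: nbhs_infty_ger.
  move=> [p n] [/= pz [nK nr]] _; set z : C := p.1 +i* p.2.
  have {}pz : cabs (z - z0) < r / 4 by exact: pz.
  have [|b [fb hb]] := reexpand (z1 := z) fa.
    by apply: lt_trans pz _; lra.
  have K0 := coef_bound_ge0 aK.
  have n0 : (0 : R) < n.+1%:R by rewrite ltr0n.
  have nr8 : n.+1%:R^-1 <= r / 8.
    rewrite -[leRHS]invrK lef_pV2 ?posrE ?invr_gt0 ?divr_gt0 ?ltr0n//.
    by rewrite invf_div (le_trans nr)// ler_nat.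
  have v0 : (0 : R) <= n.+1%:R^-1 by rewrite invr_ge0.
  have nrz : n.+1%:R^-1 <= r - cabs (z - z0).
    by rewrite (le_trans nr8)//; lra.
  exists b; split; first exact: represents_le fb.
  move: v0 nr8 nrz => /=; set v : R := n.+1%:R^-1 => v0 nr8 nrz.
  move=> j; apply: (@le_trans _ _ (K / (1 - (cabs (z - z0) + v) / (r / 2)))).
    apply: (reexpand_coef_bound _ _ aK (hb j)); [by []|lra].
  have h1 : 4^-1 <= 1 - (cabs (z - z0) + v) / (r / 2).
    by rewrite lerBrDr -lerBrDl ler_pdivrMr; lra.
  apply: (@le_trans _ _ (4 * K)).
    rewrite ler_pdivrMr; last by apply: lt_le_trans h1; rewrite invr_gt0.
    apply: (@le_trans _ _ (4 * K * 4^-1)); first by lra.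
    by rewrite ler_wpM2l// mulr_ge0.
  apply: le_trans nK; rewrite lerDr divr_ge0//; lra.
move=> N _ /(_ N (leqnn N)) PN.
exists N.+1%:R^-1, N%:R; split; first by rewrite invr_gt0 ltr0n.
move=> z zr; have := PN (complex.Re z, complex.Im z).
rewrite /P/=; case: z zr => x y zr /=; apply => //.
have := ler_Re_cabs (x +i* y); have := ler_Im_cabs (x +i* y).
by rewrite /= !ler_norml !in_itv/= => /andP[? ?] /andP[? ?]; split; apply/andP; split; lra.
Qed.

(* The j-th Taylor coefficients of [f] at the points of the circle of radius
   [s] are the values there of the power series [sum_k C(k+j, j) a_(k+j) z^k];
   so Cauchy's estimate bounds the coefficients of the latter. *)
Lemma reexpand_cauchy_estimate f a r s d M : represents f 0 a r -> 0 < s < r ->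
  0 < d -> (forall z, cabs z = s -> exists b, represents f z b d /\
    forall j, cabs (b j) * d ^+ j <= M) ->
  forall m j, (j <= m)%N -> cabs (a m) * s ^+ (m - j) *+ 'C(m, j) * d ^+ j <= M.
Proof.
move=> fa /andP[s0 sr] d0 fb m j jm.
pose c k := a (k + j)%N *+ 'C(k + j, j).
have : forall z, exists l : C, cabs z < r ->
  series (fun k => a k * z ^+ (k - j) *+ 'C(k, j)) n @[n --> \oo] --> l.
  move=> z; have [zr|] := ltP (cabs z) r; last by exists 0.
  have [|b [_ /(_ j)]] := reexpand (z1 := z) fa; first by rewrite subr0.
  by rewrite subr0 => hb; exists (b j).
move=> /choice[F hF].
have Fc : represents F 0 c r.
  move=> z; rewrite subr0 => zr; have := hF z zr.
  rewrite -(cvg_shiftn j).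
  rewrite (_ : (fun n => _) = power_series c 0 z)//.
  apply/funext => n; rewrite /power_series /series/=.
  rewrite (big_cat_nat (leq0n j) (leq_addl n j))/=.
  rewrite big_nat big1 ?add0r; last first.
    by move=> i /andP[_ ij]; rewrite bin_small// mulr0n.
  rewrite -{1}(add0n j) big_addn addnK; apply: eq_bigr => i _.
  by rewrite addnK subr0 /c mulrnAl.
have := cauchy_estimate (s := s) (M := M / d ^+ j) Fc _ _ (m - j)%N.
rewrite s0 sr ler_pdivlMr ?exprn_gt0// => H.
rewrite /c subnK// -mulr_natr cabsM cabs_nat mulr_natr mulrnAl in H.
apply: H => // z; rewrite subr0 => zs.
have [b [fb' bM]] := fb z zs.
have [|b' [fb'' hb']] := reexpand (z1 := z) fa; first by rewrite subr0 zs.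
rewrite subr0 zs in fb'' hb'.
have mn0 : 0 < Num.min d (r - s) by rewrite lt_min d0 subr_gt0.
(* The hypothesis and the re-expansion of [f] give two Taylor series at [z]; they agree by
   uniqueness on the smaller disc, which transfers the bound [M] to [F z]. *)
have bb : b = b'.
  apply: (represents_unique (f := f) (g := f) mn0) => //.
    by apply: represents_le fb'; rewrite ge_min lexx.
  by apply: represents_le fb''; rewrite ge_min lexx orbT.
have -> : F z = b' j.
  by apply: cvg_unique (hb' j) => //; apply: hF; rewrite zs.
by rewrite -bb ler_pdivlMr ?exprn_gt0.
Qed.

Lemma represents_extend f a r d M rho : 0 < d -> 0 < r <= rho ->
  (forall z, cabs z <= rho -> exists b, represents f z b d /\
    forall j, cabs (b j) * d ^+ j <= M) ->
  represents f 0 a r -> represents f 0 a (r + d / 4).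
Proof.
move=> d0 /andP[r0 rrho] fd fa.
(* [r / 2] keeps [s] positive, and [r - d / 4 <= s] makes the new radius [s + d / 2] at least
   [r + d / 4]. *)
pose s := Num.max (r / 2) (r - d / 4).
have s0 : 0 < s by rewrite lt_max divr_gt0.
have sr : s < r by rewrite gt_max; apply/andP; split; lra.
have rs : r - d / 4 <= s by rewrite le_max lexx orbT.
apply: (@represents_le _ _ _ _ (s + d / 2)); first by lra.
have sd0 : 0 < s + d / 2 by lra.
have aK m : cabs (a m) * (s + d / 2) ^+ m <= 2 * M.
  have M0 : 0 <= M.
    have [|b [_ /coef_bound_ge0//]] := fd 0; first by rewrite cabs0; lra.
  (* In the binomial expansion of [(s + d / 2) ^+ m], the estimate [reexpand_cauchy_estimate]
     absorbs [d ^+ j] and leaves the factor [2^-1 ^+ j], which sums to at most 2. *)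
  apply: (@le_trans _ _ (\sum_(0 <= j < m.+1) M * (2^-1) ^+ j)).
    rewrite exprDn mulr_sumr big_mkord ler_sum// => j _.
    have jm : (j <= m)%N by rewrite -ltnS.
    have := reexpand_cauchy_estimate fa (s := s) _ d0 _ jm.
    rewrite s0 sr => /(_ M isT) H.
    rewrite exprMn (_ : _ * (_ *+ _) =
      cabs (a m) * s ^+ (m - j) *+ 'C(m, j) * d ^+ j * 2^-1 ^+ j); last first.
      by rewrite mulrnAr !mulrnAl !mulrA.
    by apply: ler_wpM2r; [rewrite exprn_ge0|apply: H => z zs; apply: fd; lra].
  rewrite -mulr_sumr mulrC ler_wpM2r//.
  have := @geometric_sum_le R 2^-1 0 m.+1.
  by rewrite expr0; have -> : 1 / (1 - 2^-1) = 2 :> R by [field]; apply; lra.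
have [h ha] := coef_bound_represents 0 sd0 aK.
move=> z; rewrite subr0 => zs; have [zr|rz] := ltP (cabs z) r.
  by apply: fa; rewrite subr0.
suff -> : f z = h z by apply: ha; rewrite subr0.
have z0 : 0 < cabs z by lra.
(* The point of modulus [s] on the ray through [z]. Near [w] the functions [f] and [h] coincide, so
   they have the same Taylor series there; since [cabs (z - w) < d / 2], that series reaches [z] for
   both. *)
pose w : C := (s / cabs z)%:C * z.
have wE : cabs w = s.
  rewrite /w cabsM cabs_real ger0_norm ?divr_ge0 ?(ltW s0) ?(ltW z0)//.
  by rewrite divfK ?gt_eqF.
have zw : cabs (z - w) = cabs z - s.
  have -> : z - w = (1 - s / cabs z)%:C * z.
    by rewrite rmorphB/= mulrBl mul1r.
  rewrite cabsM cabs_real ger0_norm; last first.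
    by rewrite subr_ge0 ler_pdivrMr// mul1r; lra.
  by rewrite mulrBl mul1r divfK ?gt_eqF.
have [|b [fb _]] := fd w; first by lra.
have [|b' [hb' _]] := reexpand (z1 := w) ha; first by rewrite subr0 wE; lra.
rewrite subr0 wE in hb'.
have mn0 : 0 < Num.min (r - s) (d / 2) by rewrite lt_min subr_gt0 sr divr_gt0.
have bb : b = b'.
  apply: (represents_unique (f := f) (g := h) mn0).
  - move=> y; rewrite lt_min => /andP[yr yd].
    have yr' : cabs (y - 0) < r.
      by have := cabsD (y - w) w; rewrite subrK subr0 wE; lra.
    apply: (cvg_unique _ (fa y yr') (ha y _)) => //; lra.
  - by apply: represents_le fb; rewrite ge_min; apply/orP; right; lra.
  - by apply: represents_le hb'; rewrite ge_min; apply/orP; right; lra.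
have zd : cabs (z - w) < d by lra.
have zd' : cabs (z - w) < s + d / 2 - s by lra.
rewrite bb in fb.
exact: (cvg_unique _ (fb z zd) (hb' z zd')).
Qed.

Lemma analytic_disc_represents f : analytic_disc f ->
  exists a, represents f 0 a 1.
Proof.
move=> af.
have /af/analytic_atP[a [r0 [r00 fa0]]] : disc (0 : C).
  by apply/disc_cabs; rewrite cabs0.
exists a.
suff fa rho : 0 < rho < 1 -> represents f 0 a rho.
  move=> z; rewrite subr0 => z1; apply: (fa ((cabs z + 1) / 2)).
    by have := cabs_ge0 z; lra.
  by rewrite subr0; lra.
move=> /andP[rho0 rho1].
have [d [M [d0 fd]]] := analytic_uniform_radius af rho1.
(* The gain [d / 4] is fixed once [rho] is, so finitely many extensions reach [rho]; an extension is
   made only while the radius is still below [rho]. *)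
have step n : exists r, [/\ 0 < r, represents f 0 a r &
    rho <= r \/ n%:R * (d / 4) <= r].
  elim: n => [|n [r [r0' fa [rr|nr]]]].
  - by exists r0; split=> //; right; rewrite mul0r ltW.
  - by exists r; split=> //; left.
  - have [rr|rr] := leP rho r; first by exists r; split=> //; left.
    exists (r + d / 4); split; first by lra.
      by apply: (represents_extend d0 _ fd fa); rewrite r0' ltW.
    by right; rewrite -natr1 mulrDl mul1r lerD2r.
have d4 : 0 < d / 4 by rewrite divr_gt0.
pose N := (Num.truncn (rho / (d / 4))).+1.
have [r [_ fa [rr|Nr]]] := step N; apply: represents_le fa => //.
apply: le_trans Nr; rewrite -ler_pdivrMr// ltW//.
by rewrite /N truncnS_gt.
Qed.

End Continuation.

(** * The operator [Tg] on power series *)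

Section IntegrationOperator.
Context {R : realType}.
Local Notation C := R[i]^o.
Local Notation mu := (@lebesgue_measure R).
Implicit Types (f g h : C -> C) (a b d : nat -> C) (z w : C) (r s K : R).

(** The derivative at [z] is the coefficient of index 1 of the re-expansion at [z], and [reexpand]
    gives that coefficient as a power series in [z]. *)
Lemma represents_derive1 g a r : represents g 0 a r ->
  represents (derive1 g) 0 (fun n => n.+1%:R * a n.+1) r.
Proof.
move=> ga z; rewrite subr0 => zr.
have [|b [gb hb]] := reexpand (z1 := z) ga; first by rewrite subr0.
rewrite subr0 in gb hb.
rewrite (represents_derive _ gb) ?subr_gt0//.
have := hb 1%N; rewrite -cvg_shiftS.
rewrite (_ : (fun n => _) = power_series (fun n => n.+1%:R * a n.+1) 0 z)//.
apply/funext => n; rewrite /power_series /series/= big_nat_recl//= bin_small//.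
rewrite mulr0n add0r; apply: eq_bigr => i _.
by rewrite subr0 bin1 subSS subn0 -mulr_natl mulrA.
Qed.

Lemma sum_triangle (V : nmodType) (F : nat -> nat -> V) n :
  \sum_(0 <= m < n) \sum_(0 <= k < m.+1) F k (m - k)%N =
  \sum_(0 <= k < n) \sum_(0 <= l < n - k) F k l.
Proof.
elim: n => [|n IH]; first by rewrite !big_geq.
rewrite big_nat_recr//= IH big_nat_recr//= big_nat_recr//= addrA; congr (_ + _).
  rewrite -big_split/=; apply: eq_big_nat => k /andP[_ kn].
  by rewrite subSn ?(ltnW kn)// big_nat_recr.
by rewrite subSn// subnn big_nat1.
Qed.

Definition cauchy_product (V : pzSemiRingType) (a b : nat -> V) (m : nat) : V :=
  \sum_(0 <= k < m.+1) a k * b (m - k)%N.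

Lemma power_series_cauchy_product a b z n :
  power_series (cauchy_product a b) 0 z n =
  \sum_(0 <= k < n) \sum_(0 <= l < n - k) (a k * z ^+ k) * (b l * z ^+ l).
Proof.
rewrite -(sum_triangle (fun k l => (a k * z ^+ k) * (b l * z ^+ l))).
rewrite /power_series /series/=; apply: eq_bigr => m _.
rewrite subr0 mulr_suml; apply: eq_big_nat => k /andP[_ km].
by rewrite mulrACA -exprD subnKC.
Qed.

(** The pairs absent from the Cauchy product satisfy [n <= k + l]. The ratio is written [p ^+ 2] so
    that half of the decay yields [p ^+ n] while the other half keeps the double sum bounded. *)
Lemma cabs_product_remainder a b z n Ka Kb (p : R) : 0 <= p < 1 ->
  0 <= Ka -> 0 <= Kb ->
  (forall k, cabs (a k * z ^+ k) <= Ka * (p ^+ 2) ^+ k) ->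
  (forall k, cabs (b k * z ^+ k) <= Kb * (p ^+ 2) ^+ k) ->
  cabs (power_series a 0 z n * power_series b 0 z n -
        power_series (cauchy_product a b) 0 z n) <=
  Ka * Kb / (1 - p) ^+ 2 * p ^+ n.
Proof.
move=> p01 Ka0 Kb0 aK bK; have /andP[p0 p1] := p01.
pose u k := a k * z ^+ k; pose v k := b k * z ^+ k.
have aE : power_series a 0 z n = \sum_(0 <= k < n) u k.
  by apply: eq_bigr => k _; rewrite subr0.
have bE : power_series b 0 z n = \sum_(0 <= k < n) v k.
  by apply: eq_bigr => k _; rewrite subr0.
have -> : power_series a 0 z n * power_series b 0 z n -
    power_series (cauchy_product a b) 0 z n =
    \sum_(0 <= k < n) \sum_(n - k <= l < n) u k * v l.
  rewrite aE bE power_series_cauchy_product mulr_suml -sumrB.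
  apply: eq_big_nat => k /andP[_ kn].
  rewrite mulr_sumr (big_cat_nat (leq0n (n - k)) (leq_subr k n))/=.
  by rewrite addrAC subrr add0r.
apply: (le_trans (cabs_sum _ _ _)).
apply: (@le_trans _ _ (\sum_(0 <= k < n) \sum_(0 <= l < n)
    (Ka * p ^+ k) * (Kb * p ^+ l) * p ^+ n)).
  apply: ler_sum_nat => k /andP[_ kn].
  apply: (le_trans (cabs_sum _ _ _)).
  rewrite [leRHS](big_cat_nat (leq0n (n - k)) (leq_subr k n))/=.
  rewrite -[leLHS]add0r; apply: lerD.
    by apply: sumr_ge0 => l _; rewrite !mulr_ge0 ?exprn_ge0.
  apply: ler_sum_nat => l /andP[kl _].
  rewrite cabsM (le_trans (ler_pM (cabs_ge0 _) (cabs_ge0 _) (aK k) (bK l)))//.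
  rewrite -!exprM !mul2n -!addnn !exprD.
  rewrite [leLHS](_ : _ = (Ka * p ^+ k) * (Kb * p ^+ l) * p ^+ (k + l)).
    2: by rewrite exprD; ring.
  rewrite ler_wpM2l ?mulr_ge0 ?exprn_ge0//.
  by rewrite ler_wiXn2l ?(ltW p1)// -leq_subLR.
pose S := \sum_(0 <= k < n) p ^+ k.
have -> : \sum_(0 <= k < n) \sum_(0 <= l < n)
    (Ka * p ^+ k) * (Kb * p ^+ l) * p ^+ n = Ka * Kb * (S * S) * p ^+ n.
  transitivity (\sum_(0 <= k < n) (Ka * Kb * S * p ^+ n) * p ^+ k).
    apply: eq_bigr => k _; rewrite -mulr_suml -mulr_sumr -mulr_sumr -/S.
    by ring.
  by rewrite -mulr_sumr -/S; ring.
apply: ler_wpM2r; first exact: exprn_ge0.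
apply: ler_wpM2l; first exact: mulr_ge0.
have S0 : 0 <= S by apply: sumr_ge0 => i _; exact: exprn_ge0.
have := geometric_sum_le 0 n p01; rewrite expr0 mul1r => H.
by rewrite -exprVn expr2 ler_pM.
Qed.

Lemma represents_mul f g a b r : represents f 0 a r -> represents g 0 b r ->
  represents (fun w => f w * g w) 0 (cauchy_product a b) r.
Proof.
move=> fa gb z zr; have := zr; rewrite subr0 => zr'.
pose s := (cabs z + r) / 2; have z0 := cabs_ge0 z.
have s0 : 0 < s by rewrite /s; lra.
have sr : 0 <= s < r by rewrite /s; apply/andP; split; lra.
have [Ka aK] := represents_coef_bound fa sr.
have [Kb bK] := represents_coef_bound gb sr.
have Ka0 := coef_bound_ge0 aK.
have Kb0 := coef_bound_ge0 bK.
(* The square root supplies the ratio in the form [p ^+ 2]. *)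
pose p := Num.sqrt (cabs z / s).
have pE : p ^+ 2 = cabs z / s by rewrite sqr_sqrtr// divr_ge0 ?(ltW s0).
have p0 : 0 <= p by rewrite sqrtr_ge0.
have p1 : p < 1.
  rewrite -(ltr_pXn2r (ltn0Sn 1)) ?nnegrE// expr1n pE.
  by rewrite ltr_pdivrMr// mul1r /s; lra.
pose E n := power_series a 0 z n * power_series b 0 z n -
  power_series (cauchy_product a b) 0 z n.
have E0 : E n @[n --> \oo] --> (0 : C).
  apply: (@cvg_cabs_le _ _ _ (fun n => Ka * Kb / (1 - p) ^+ 2 * p ^+ n)).
    move=> n; rewrite sub0r cabsN /E; apply: cabs_product_remainder => //.
    - by rewrite p0.
    - by move=> k; rewrite pE; exact: coef_bound_term.
    - by move=> k; rewrite pE; exact: coef_bound_term.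
  rewrite -[X in _ --> X](mulr0 (Ka * Kb / (1 - p) ^+ 2)); apply: cvgMr.
  by apply: cvg_expr; rewrite ger0_norm.
have -> : power_series (cauchy_product a b) 0 z =
    (fun n => power_series a 0 z n * power_series b 0 z n - E n).
  by apply/funext => n; rewrite /E opprB addrCA subrr addr0.
rewrite -[f z * g z]subr0.
exact: (cvgcB (cvgcM (fa z zr) (gb z zr)) E0).
Qed.

Definition primitive_coef d (n : nat) : C :=
  if n is m.+1 then d m / m.+1%:R else 0.

Lemma Rintegral_polynomial (c : nat -> R) n :
  continuous (fun t : R => \sum_(0 <= k < n) c k * t ^+ k) /\
  \int[mu]_(t in `[0, 1]) (\sum_(0 <= k < n) c k * t ^+ k) =
  \sum_(0 <= k < n) c k / k.+1%:R.
Proof.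
elim: n => [|n [cn IH]].
  rewrite big_geq// (_ : (fun t => _) = cst 0).
    by split; [move=> t; exact: cvg_cst|rewrite Rintegral_cst// mul0r].
  by apply/funext => t; rewrite big_geq.
have -> : (fun t : R => \sum_(0 <= k < n.+1) c k * t ^+ k) =
    (fun t => (\sum_(0 <= k < n) c k * t ^+ k) + c n * t ^+ n).
  by apply/funext => t; rewrite big_nat_recr.
have ct : continuous (fun t : R => c n * t ^+ n).
  by move=> t; apply: cvgM; [exact: cvg_cst|exact: exprn_continuous].
split; first by move=> t; apply: cvgD; [exact: cn|exact: ct].
rewrite RintegralD//; [|exact: (@continuous_integrable_segment _ _ _ _ cn)
  |exact: (@continuous_integrable_segment _ _ _ _ ct)].
rewrite IH big_nat_recr//=; congr (_ + _).
rewrite RintegralZl//; first by rewrite Rintegral_expr.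
by apply: continuous_integrable_segment; exact: exprn_continuous.
Qed.

(** On the segment from 0 to [z] the integrand is a uniform limit, in [t], of the polynomials with
    coefficients [d k * z ^+ k.+1]; these are integrated term by term. *)
Lemma represents_Tg g f d : represents (fun w => f w * derive1 g w) 0 d 1 ->
  represents (Tg g f) 0 (primitive_coef d) 1.
Proof.
move=> Gd z; rewrite subr0 => z1.
set G := fun w => f w * derive1 g w.
have z0 := cabs_ge0 z.
pose s := (cabs z + 1) / 2.
have s0 : 0 < s by rewrite /s; lra.
have s1 : 0 <= s < 1 by rewrite /s; apply/andP; split; lra.
have [K dK] := represents_coef_bound Gd s1.
pose q := cabs z / s.
have q01 : 0 <= q < 1.
  by rewrite /q divr_ge0 ?(ltW s0)//= ltr_pdivrMr// mul1r /s; lra.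
pose e n := K * q ^+ n / (1 - q).
have e0 : e n @[n --> \oo] --> 0 := cvg_geometric_tail K q01.
pose c k := d k * z ^+ k.+1.
pose F t : C := G (t%:C * z) * z.
have Fc n t : t \in `[0, 1] ->
    cabs (F t - \sum_(0 <= k < n) c k * (t ^+ k)%:C) <= e n.
  rewrite in_itv/= => /andP[t0 t1].
  have tz : cabs (t%:C * z) <= cabs z.
    by rewrite cabsM cabs_real ger0_norm// ler_piMl.
  have bk k : cabs (d k * (t%:C * z - 0) ^+ k) <= K * q ^+ k.
    rewrite subr0; apply: le_trans (coef_bound_term z s0 dK k).
    rewrite !cabsM ler_wpM2l ?cabs_ge0// !cabsX.
    by rewrite lerXn2r// nnegrE ?cabs_ge0.
  have := series_geometric_tail n q01 bk (Gd _ _).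
  rewrite subr0 => /(_ (le_lt_trans tz z1)) H.
  have -> : \sum_(0 <= k < n) c k * (t ^+ k)%:C =
      series (fun k => d k * (t%:C * z) ^+ k) n * z.
    rewrite /series/= mulr_suml; apply: eq_bigr => k _.
    by rewrite /c exprMn rmorphXn/= exprSr; ring.
  rewrite /F -mulrBl cabsM.
  exact: (le_trans (ler_piMr (cabs_ge0 _) (ltW z1)) H).
(* The constant coefficient of the primitive is 0, whence the shift by one. *)
rewrite -cvg_shiftS.
have -> : (fun n => power_series (primitive_coef d) 0 z n.+1) =
    (fun n => \sum_(0 <= k < n) c k / k.+1%:R).
  apply/funext => n; rewrite /power_series /series/= big_nat_recl//= mul0r add0r.
  by apply: eq_bigr => k _; rewrite subr0 mulrAC.
have ReZ (u : C) x : complex.Re (u * x%:C) = complex.Re u * x.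
  by case: u => u v /=; rewrite mulr0 subr0.
have ImZ (u : C) x : complex.Im (u * x%:C) = complex.Im u * x.
  by case: u => u v /=; rewrite mulr0 add0r.
have ReS n (u : nat -> C) :
    complex.Re (\sum_(0 <= k < n) u k) = \sum_(0 <= k < n) complex.Re (u k).
  by rewrite raddf_sum.
have ImS n (u : nat -> C) :
    complex.Im (\sum_(0 <= k < n) u k) = \sum_(0 <= k < n) complex.Im (u k).
  by rewrite raddf_sum.
have natV k : (k.+1%:R^-1 : C) = (k.+1%:R^-1)%:C.
  by rewrite fmorphV rmorph_nat.
apply/cvg_complexP; split.
- have [||ih cv] := @cvg_Rintegral_uniform _
      (fun n t => \sum_(0 <= k < n) complex.Re (c k) * t ^+ k)
      (fun t => complex.Re (F t)) e 0 1 ler01 _ _ e0.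
  + by move=> n; exact: (Rintegral_polynomial _ n).1.
  + move=> n t t01; apply: le_trans (Fc n t t01); apply: le_trans (ler_Re_cabs _).
    rewrite raddfB/= ReS; under [X in _ <= `|_ - X|]eq_bigr do rewrite ReZ.
    exact: lexx.
  apply: cvg_trans cv; apply: near_eq_cvg; apply: nearW => n.
  rewrite (Rintegral_polynomial _ n).2 ReS; apply: eq_bigr => k _.
  by rewrite natV ReZ.
- have [||ih cv] := @cvg_Rintegral_uniform _
      (fun n t => \sum_(0 <= k < n) complex.Im (c k) * t ^+ k)
      (fun t => complex.Im (F t)) e 0 1 ler01 _ _ e0.
  + by move=> n; exact: (Rintegral_polynomial _ n).1.
  + move=> n t t01; apply: le_trans (Fc n t t01); apply: le_trans (ler_Im_cabs _).
    rewrite raddfB/= ImS; under [X in _ <= `|_ - X|]eq_bigr do rewrite ImZ.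
    exact: lexx.
  apply: cvg_trans cv; apply: near_eq_cvg; apply: nearW => n.
  rewrite (Rintegral_polynomial _ n).2 ImS; apply: eq_bigr => k _.
  by rewrite natV ImZ.
Qed.

End IntegrationOperator.

(** * The Hardy norm and the coefficients *)

Section HardyNorm.
Context {R : realType}.
Local Notation C := R[i]^o.
Local Notation mu := (@lebesgue_measure R).
Implicit Types (f g : C -> C) (a : nat -> C) (z w : C) (r s M : R).

Lemma M2_sqrt f a r : represents f 0 a 1 -> 0 < r < 1 ->
  M2 r f = (Num.sqrt ((2 * pi)^-1 *
    \int[mu]_(t in `[0%R, 2 * pi]) cabs (f (circle_point r t)) ^+ 2))%:E.
Proof.
move=> fa r01; have [ih _] := represents_parseval fa r01.
rewrite /M2 -powR12_sqrt; last first.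
  rewrite mulr_ge0 ?invr_ge0 ?mulr_ge0 ?pi_ge0//.
  by apply: Rintegral_ge0 => t _; rewrite exprn_ge0// cabs_ge0.
rewrite -poweR_EFin EFinM; congr (_ `^ _)%E; congr (_ * _)%E.
by rewrite /Rintegral fineK//; exact: integrable_fin_num.
Qed.

(** Parseval on the circle of radius [r] bounds a finite sum, in which [r] then tends to 1. With the
    converse below, this identifies the Hardy norm with the l^2 norm of the coefficients. *)
Lemma H2norm_coef_le f a M : represents f 0 a 1 -> (H2norm f <= M%:E)%E ->
  forall n, \sum_(0 <= k < n) cabs (a k) ^+ 2 <= M ^+ 2.
Proof.
move=> fa fM n.
have pi2 : 0 < 2 * pi :> R by rewrite mulr_gt0 ?pi_gt0.
have rM r : 0 < r < 1 -> \sum_(0 <= k < n) (cabs (a k) * r ^+ k) ^+ 2 <= M ^+ 2.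
  move=> r01; have [_ cv] := represents_parseval fa r01.
  have /andP[r0 r1] := r01.
  have : (M2 r f <= M%:E)%E.
    by apply: le_trans fM; apply: ereal_sup_ubound; exists r.
  rewrite (M2_sqrt fa r01) lee_fin => IM.
  have M0 : 0 <= M by apply: le_trans IM; exact: sqrtr_ge0.
  have I0 : 0 <= \int[mu]_(t in `[0%R, 2 * pi]) cabs (f (circle_point r t)) ^+ 2.
    by apply: Rintegral_ge0 => t _; rewrite exprn_ge0// cabs_ge0.
  rewrite -(ler_pXn2r (ltn0Sn 1)) ?nnegrE ?sqrtr_ge0// sqr_sqrtr in IM; last first.
    by rewrite mulr_ge0 ?invr_ge0 ?(ltW pi2).
  apply: le_trans IM; rewrite mulrC ler_pdivlMr// mulrC.
  apply: (cvgr_to_ge cv); exists n => // m /= nm.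
  rewrite ler_pM2l// [leRHS](big_cat_nat (leq0n n) nm)/= lerDl.
  by apply: sumr_ge0 => k _; exact: sqr_ge0.
have cv : \sum_(0 <= k < n) (cabs (a k) * r ^+ k) ^+ 2 @[r --> (1 : R)^'-] -->
    \sum_(0 <= k < n) cabs (a k) ^+ 2.
  apply: cvg_at_left_filter.
  have -> : \sum_(0 <= k < n) cabs (a k) ^+ 2 =
      \sum_(0 <= k < n) (cabs (a k) * 1 ^+ k) ^+ 2.
    by apply: eq_bigr => k _; rewrite expr1n mulr1.
  apply: cvg_sumr => k; rewrite [X in _ --> X]expr2; under eq_fun do rewrite expr2.
  by apply: cvgM; apply: cvgM; solve [exact: cvg_cst|exact: exprn_continuous].
apply: (cvgr_to_le cv); near=> r; apply: rM; apply/andP; split; near: r.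
  exact: nbhs_left_gt.
exact: nbhs_left_lt.
Unshelve. all: by end_near. Qed.

(** For [r < 1] the factors [r ^+ k] only decrease the terms of Parseval's sum. *)
Lemma H2norm_le_coef f a M : represents f 0 a 1 -> 0 <= M ->
  (forall n, \sum_(0 <= k < n) cabs (a k) ^+ 2 <= M ^+ 2) ->
  (H2norm f <= M%:E)%E.
Proof.
move=> fa M0 aM; apply: ub_ereal_sup => _ [r /= +] <-.
rewrite in_itv/= => r01; have /andP[r0 r1] := r01.
have [_ cv] := represents_parseval fa r01.
have pi2 : 0 < 2 * pi :> R by rewrite mulr_gt0 ?pi_gt0.
rewrite (M2_sqrt fa r01) lee_fin.
rewrite -(ger0_norm M0) -sqrtr_sqr; apply: ler_wsqrtr; rewrite ler_pdivrMl//.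
apply: (cvgr_to_le cv); apply: nearW => n.
rewrite ler_pM2l//; apply: le_trans (aM n); apply: ler_sum => k _.
rewrite lerXn2r ?nnegrE ?mulr_ge0 ?cabs_ge0 ?exprn_ge0 ?(ltW r0)//.
by rewrite ler_piMr ?cabs_ge0// exprn_ile1 ?(ltW r0) ?(ltW r1).
Qed.

Lemma H2norm_ge0 f : (0 <= H2norm f)%E.
Proof.
apply: (@le_trans _ _ (M2 2^-1 f)); first exact: poweR_ge0.
apply: ereal_sup_ubound; exists 2^-1 => //.
by rewrite /= in_itv/= invr_gt0 ltr0n/= invf_lt1// ltr1n.
Qed.

Lemma Hoonorm_ge0 f : (0 <= Hoonorm f)%E.
Proof.
apply: (@le_trans _ _ (cabs (f 0))%:E); first by rewrite lee_fin cabs_ge0.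
by apply: ereal_sup_ubound; exists 0 => //; apply/disc_cabs; rewrite cabs0.
Qed.

Lemma Hoonorm_le f M : (forall z, cabs z < 1 -> cabs (f z) <= M) ->
  (Hoonorm f <= M%:E)%E.
Proof.
move=> fM; apply: ub_ereal_sup => _ [z /= /disc_cabs z1 <-].
by rewrite lee_fin fM.
Qed.

Lemma H2_represents f : H2 f -> exists a M, [/\ represents f 0 a 1, 0 <= M,
  H2norm f = M%:E & forall n, \sum_(0 <= k < n) cabs (a k) ^+ 2 <= M ^+ 2].
Proof.
move=> [/analytic_disc_represents[a fa] fy].
have fN : H2norm f = (fine (H2norm f))%:E.
  by rewrite fineK// ge0_fin_numE ?H2norm_ge0.
exists a, (fine (H2norm f)); split=> //; first by rewrite fine_ge0// H2norm_ge0.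
by apply: (H2norm_coef_le fa); rewrite fN.
Qed.

End HardyNorm.

(** * The Cauchy-Schwarz inequality for finite sums *)

Section CauchySchwarzSum.
Context {R : realType}.

Lemma sum_cauchy_schwarz (I : Type) (s : seq I) (x y : I -> R) :
  (\sum_(i <- s) x i * y i) ^+ 2 <=
  (\sum_(i <- s) x i ^+ 2) * (\sum_(i <- s) y i ^+ 2).
Proof.
elim: s => [|i s IH]; first by rewrite !big_nil mul0r expr0n.
rewrite !big_cons; move: IH.
set P := \sum_(j <- s) _; set X := \sum_(j <- s) _ ^+ 2.
set Y := \sum_(j <- s) y j ^+ 2; set u := x i; set v := y i => PXY.
have X0 : 0 <= X by apply: sumr_ge0 => j _; exact: sqr_ge0.
have Y0 : 0 <= Y by apply: sumr_ge0 => j _; exact: sqr_ge0.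
(* The inductive step is this cross-term inequality; squared, it follows from [P ^+ 2 <= X * Y] and
   the inequality of arithmetic and geometric means. *)
suff : 2 * P * u * v <= X * v ^+ 2 + Y * u ^+ 2.
  move=> H; rewrite -subr_ge0 (_ : _ - _ = (X * Y - P ^+ 2) +
    (X * v ^+ 2 + Y * u ^+ 2 - 2 * P * u * v)); last by ring.
  by rewrite addr_ge0// subr_ge0.
have XY0 : 0 <= X * v ^+ 2 + Y * u ^+ 2 by apply: addr_ge0; apply: mulr_ge0 => //; exact: sqr_ge0.
apply: (le_trans (ler_norm _)).
rewrite -(ler_pXn2r (ltn0Sn 1)) ?nnegrE// real_normK ?num_real//.
apply: (@le_trans _ _ (4 * (X * Y) * (u * v) ^+ 2)).
  rewrite (_ : (2 * P * u * v) ^+ 2 = 4 * P ^+ 2 * (u * v) ^+ 2); last by ring.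
  by rewrite ler_wpM2r ?sqr_ge0// ler_wpM2l.
rewrite -subr_ge0 (_ : _ - _ = (X * v ^+ 2 - Y * u ^+ 2) ^+ 2); last by ring.
exact: sqr_ge0.
Qed.

Lemma sum_mul_le (I : Type) (s : seq I) (x y : I -> R) (A B : R) :
  0 <= A -> 0 <= B -> \sum_(i <- s) x i ^+ 2 <= A ^+ 2 ->
  \sum_(i <- s) y i ^+ 2 <= B ^+ 2 -> \sum_(i <- s) x i * y i <= A * B.
Proof.
move=> A0 B0 xA yB; apply: (le_trans (ler_norm _)).
rewrite -(ler_pXn2r (ltn0Sn 1)) ?nnegrE ?mulr_ge0// real_normK ?num_real//.
rewrite exprMn (le_trans (sum_cauchy_schwarz _ _ _))//.
by apply: ler_pM => //; apply: sumr_ge0 => i _; exact: sqr_ge0.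
Qed.

End CauchySchwarzSum.

(** * Bounds for [Tg] *)

Section TgCoef.
Context {R : realType}.
Local Notation C := R[i]^o.
Implicit Types (f g h : C -> C) (a : nat -> C) (b S : nat -> R) (z w : C).
Implicit Types (A H M : R).

Definition Tg_coef b a := primitive_coef (cauchy_product a (fun n => (b n)%:C : C)).

(** A truncated inner sum of [hilbert_sum], kept in [R] so that a divergent inner sum is handled
    through its partial sums. *)
Definition hilbert_partial b (k n : nat) : R :=
  \sum_(0 <= l < n) b l / (l + k + 1)%:R.

Lemma represents_Tg_coef g (ghat : nat -> R) f a :
  maclaurin g ghat -> represents f 0 a 1 ->
  represents (Tg g f) 0 (Tg_coef (fun n => n.+1%:R * ghat n.+1) a) 1.
Proof.
move=> gm fa.
have ga : represents g 0 (fun n => (ghat n)%:C : C) 1.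
  by move=> z; rewrite subr0 => /disc_cabs; exact: gm.
have gb : represents (derive1 g) 0 (fun n => (n.+1%:R * ghat n.+1)%:C : C) 1.
  rewrite (_ : (fun n => _) = (fun n => n.+1%:R * (ghat n.+1)%:C)).
    exact: represents_derive1 ga.
  by apply/funext => n; rewrite rmorphM rmorph_nat.
exact: (represents_Tg (represents_mul fa gb)).
Qed.

Lemma power_series_Tg_coef b a z n :
  power_series (Tg_coef b a) 0 z n.+1 =
  \sum_(0 <= k < n) \sum_(0 <= l < n - k)
    a k * (b l)%:C * z ^+ (l + k).+1 / (l + k + 1)%:R.
Proof.
rewrite -(sum_triangle
  (fun k l => a k * (b l)%:C * z ^+ (l + k).+1 / (l + k + 1)%:R)).
rewrite /power_series /series/= big_nat_recl//= mul0r add0r.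
apply: eq_bigr => m _; rewrite subr0 mulrAC /cauchy_product !mulr_suml.
apply: eq_big_nat => k /andP[_ km]; rewrite ltnS in km.
by rewrite subnK// addn1.
Qed.

Lemma hilbert_partial_le b k m n : (forall l, 0 <= b l) -> (m <= n)%N ->
  hilbert_partial b k m <= hilbert_partial b k n.
Proof.
move=> b0 mn; rewrite /hilbert_partial [leRHS](big_cat_nat (leq0n m) mn)/= lerDl.
by apply: sumr_ge0 => l _; rewrite divr_ge0.
Qed.

Lemma hilbert_partial_ge0 b k n : (forall l, 0 <= b l) ->
  0 <= hilbert_partial b k n.
Proof. by move=> b0; apply: sumr_ge0 => l _; rewrite divr_ge0. Qed.

(** Group the terms by the coefficient [a k]; since [b] is nonnegative, the inner range [n - k] may
    be enlarged. *)
Lemma cabs_power_series_Tg_coef b a z n : (forall l, 0 <= b l) ->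
  cabs z <= 1 ->
  cabs (power_series (Tg_coef b a) 0 z n) <=
  \sum_(0 <= k < n) cabs (a k) * hilbert_partial b k n.
Proof.
move=> b0 z1.
have pos m k : 0 <= cabs (a k) * hilbert_partial b k m.
  by rewrite mulr_ge0 ?cabs_ge0 ?hilbert_partial_ge0.
case: n => [|n]; first by rewrite power_series0 cabs0 big_geq.
rewrite power_series_Tg_coef (le_trans (cabs_sum _ _ _))//.
rewrite big_nat_recr//= -[leLHS]addr0 lerD//.
apply: ler_sum => k _; rewrite (le_trans (cabs_sum _ _ _))//.
rewrite mulr_sumr.
apply: (@le_trans _ _ (\sum_(0 <= l < n - k) cabs (a k) * (b l / (l + k + 1)%:R))).
  apply: ler_sum => l _.
  rewrite !cabsM cabsV cabs_real cabs_nat (ger0_norm (b0 l)) mulrA.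
  apply: ler_wpM2r; first by rewrite invr_ge0.
  rewrite ler_piMr ?mulr_ge0 ?cabs_ge0//.
  by rewrite cabsX exprn_ile1 ?cabs_ge0.
rewrite -mulr_sumr -mulr_sumr ler_wpM2l ?cabs_ge0//.
by apply: hilbert_partial_le => //; rewrite (leq_trans (leq_subr _ _)).
Qed.

(** * Estimates from a square-summable majorant [S] of the inner sums *)

Section Bounds.
Variables (b S : nat -> R) (H : R).
Hypothesis b0 : forall l, 0 <= b l.
Hypothesis bS : forall k n, hilbert_partial b k n <= S k.
Hypothesis H0 : 0 <= H.
Hypothesis SH : forall n, \sum_(0 <= k < n) S k ^+ 2 <= H ^+ 2.

Let S0 k : 0 <= S k.
Proof. exact: le_trans (hilbert_partial_ge0 k 0 b0) (bS k 0). Qed.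

Let partial_le a z n : cabs z <= 1 ->
  cabs (power_series (Tg_coef b a) 0 z n) <=
  \sum_(0 <= k < n) cabs (a k) * S k.
Proof.
move=> z1; apply: (le_trans (cabs_power_series_Tg_coef a n b0 z1)).
by apply: ler_sum => k _; rewrite ler_wpM2l ?cabs_ge0.
Qed.

Let partial_le_norm a A z n : 0 <= A ->
  (forall n, \sum_(0 <= k < n) cabs (a k) ^+ 2 <= A ^+ 2) -> cabs z <= 1 ->
  cabs (power_series (Tg_coef b a) 0 z n) <= A * H.
Proof.
move=> A0 aA z1; apply: (le_trans (partial_le a n z1)).
exact: sum_mul_le.
Qed.

Lemma Tg_coef_bound f a A z : 0 <= A ->
  (forall n, \sum_(0 <= k < n) cabs (a k) ^+ 2 <= A ^+ 2) ->
  represents f 0 (Tg_coef b a) 1 -> cabs z < 1 -> cabs (f z) <= A * H.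
Proof.
move=> A0 aA fa z1; have := fa z; rewrite subr0 => /(_ z1)/cabs_le_lim; apply.
by apply: nearW => n; apply: partial_le_norm => //; exact: ltW.
Qed.

(** Each coefficient is the difference of two consecutive partial sums at the point 1, where the
    uniform bound still holds; bounded coefficients give convergence in the unit disc. This provides
    the limit function in the compactness proof. *)
Lemma Tg_coef_represents a A : 0 <= A ->
  (forall n, \sum_(0 <= k < n) cabs (a k) ^+ 2 <= A ^+ 2) ->
  exists h, represents h 0 (Tg_coef b a) 1.
Proof.
move=> A0 aA; apply: (@coef_bound_represents _ _ _ _ (A * H + A * H)) => // n.
have -> : cabs (Tg_coef b a n) * 1 ^+ n = cabs (power_series (Tg_coef b a) 0 1 n.+1 -
    power_series (Tg_coef b a) 0 1 n).
  by rewrite power_seriesS addrAC subrr add0r subr0 !expr1n !mulr1.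
by rewrite (le_trans (cabsB _ _))// lerD// partial_le_norm ?cabs1.
Qed.

(** Split the sum at an index [K] beyond which [S] has small l^2 norm: Cauchy-Schwarz bounds the
    tail uniformly in [j], and the head is a finite sum of sequences tending to 0. *)
Lemma Tg_coef_cvg0 (F_ : nat -> C -> C) (a_ : nat -> nat -> C) A : 0 <= A ->
  (forall j n, \sum_(0 <= k < n) cabs (a_ j k) ^+ 2 <= A ^+ 2) ->
  (forall j, represents (F_ j) 0 (Tg_coef b (a_ j)) 1) ->
  (forall k, cabs (a_ j k) @[j --> \oo] --> 0) ->
  forall e, 0 < e -> \forall j \near \oo, forall z, cabs z < 1 ->
    cabs (F_ j z) <= e.
Proof.
move=> A0 aA Fa a0 e e0.
have A1 : 0 < A + 1 by lra.
(* Chosen so that [A * eta <= e / 2]; the 1 covers [A = 0]. *)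
pose eta := e / (2 * (A + 1)).
have eta0 : 0 < eta by rewrite divr_gt0// mulr_gt0.
have [K SK] : exists K, forall n, \sum_(K <= k < n) S k ^+ 2 <= eta ^+ 2.
  have cS : cvgn (series (fun k => S k ^+ 2)).
    apply: nondecreasing_is_cvgn.
      by apply: nondecreasing_series => n _ _; exact: sqr_ge0.
    by exists (H ^+ 2) => _ [n _ <-]; exact: SH.
  have /cauchy_cvgP/cauchy_seriesP/(_ (eta ^+ 2)) := cS.
  rewrite exprn_gt0// => /(_ isT)[[P Q]/= [[N1 _ PN] [N2 _ QN]] PQ].
  exists (maxn N1 N2) => n; have [nN|Nn] := leqP n (maxn N1 N2).
    by rewrite big_geq// sqr_ge0.
  have := PQ (maxn N1 N2, n); rewrite /= => /(_ _)/ltW/(le_trans (ler_norm _)).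
  apply; split; first by apply: PN => /=; rewrite leq_maxl.
  by apply: QN => /=; apply: leq_trans (ltnW Nn); rewrite leq_maxr.
have cv0 : \sum_(0 <= k < K) cabs (a_ j k) * S k @[j --> \oo] --> (0 : R).
  rewrite [X in _ --> X](_ : 0 = \sum_(0 <= k < K) 0 * S k); last first.
    by rewrite big1// => k _; rewrite mul0r.
  by apply: cvg_sumr => k; apply: cvgMl; exact: a0.
have e20 : 0 < e / 2 by rewrite divr_gt0.
have /cvgrPdist_lt/(_ _ e20) := cv0; apply: filterS => j.
rewrite sub0r normrN => /(le_lt_trans (ler_norm _)) je z z1.
have := Fa j z; rewrite subr0 => /(_ z1)/cabs_le_lim; apply.
exists K => // n /= Kn; apply: (le_trans (partial_le (a_ j) n (ltW z1))).
rewrite (big_cat_nat (leq0n K) Kn)/=.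
have : \sum_(K <= k < n) cabs (a_ j k) * S k <= A * eta.
  apply: sum_mul_le => //; first exact: ltW.
  apply: le_trans (aA j n); rewrite [leRHS](big_cat_nat (leq0n K) Kn)/= lerDr.
  by apply: sumr_ge0 => k _; exact: sqr_ge0.
have : A * eta <= e / 2.
  rewrite (_ : e / 2 = (A + 1) * eta); first by rewrite ler_wpM2r ?(ltW eta0)//; lra.
  by rewrite /eta; field; lra.
by lra.
Qed.

End Bounds.

Lemma Tg_coefB b a a' n :
  Tg_coef b a n - Tg_coef b a' n = Tg_coef b (fun k => a k - a' k) n.
Proof.
case: n => [|n]; first by rewrite /Tg_coef/= subrr.
rewrite /Tg_coef/= -mulrBl; congr (_ / _); rewrite /cauchy_product -sumrB.
by apply: eq_bigr => k _; rewrite mulrBl.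
Qed.

Lemma represents_polynomial a K : (forall k, (K <= k)%N -> a k = 0) ->
  represents (fun z => power_series a 0 z K) 0 a 1.
Proof.
move=> aK z _.
have : cvg_to (power_series a 0 z K @[n --> \oo]) (nbhs (power_series a 0 z K)).
  exact: cvg_cst.
apply: cvg_trans; apply: near_eq_cvg; exists K => // n /= Kn.
rewrite /power_series /series/= [in RHS](big_cat_nat (leq0n K) Kn)/=.
rewrite -[LHS]addr0; congr (_ + _); apply/esym.
by rewrite big_nat big1// => k /andP[Kk _]; rewrite aK// mul0r.
Qed.

(* Testing on the polynomial with coefficients [hilbert_partial b k n / sigma],
   which has norm 1 in H2, at real points tending to 1. *)
Lemma hilbert_partial_sum_le g (ghat : nat -> R) M :
  let b n := n.+1%:R * ghat n.+1 in
  maclaurin g ghat -> (forall n, 0 <= ghat n) -> 0 <= M ->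
  (forall f, H2 f -> (H2norm f <= 1)%E -> (Hoonorm (Tg g f) <= M%:E)%E) ->
  forall K n, \sum_(0 <= k < K) hilbert_partial b k n ^+ 2 <= M ^+ 2.
Proof.
move=> b gm g0 M0 TM K n.
have b0 l : 0 <= b l by rewrite /b mulr_ge0.
set X := \sum_(_ <= _ < _) _.
have X0 : 0 <= X by apply: sumr_ge0 => k _; exact: sqr_ge0.
have [->|Xn0] := eqVneq X 0; first exact: sqr_ge0.
pose sigma := Num.sqrt X.
have sX : sigma ^+ 2 = X by exact: sqr_sqrtr.
have s0 : 0 < sigma by rewrite sqrtr_gt0 lt_def Xn0.
pose alpha k := if (k < K)%N then hilbert_partial b k n / sigma else 0.
have alpha0 k : 0 <= alpha k.
  by rewrite /alpha; case: ifP => // _; rewrite divr_ge0 ?hilbert_partial_ge0 ?(ltW s0).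
pose a k : C := (alpha k)%:C.
have aK k : (K <= k)%N -> a k = 0.
  by rewrite leqNgt /a /alpha => /negbTE ->.
have fa := represents_polynomial aK.
set f := (fun z => power_series a 0 z K) in fa.
have a1 m : \sum_(0 <= k < m) cabs (a k) ^+ 2 <= 1 ^+ 2.
  apply: (@le_trans _ _ (\sum_(0 <= k < K) cabs (a k) ^+ 2)).
    have [mK|Km] := leqP m K.
      rewrite [leRHS](big_cat_nat (leq0n m) mK)/= lerDl.
      by apply: sumr_ge0 => k _; exact: sqr_ge0.
    rewrite (big_cat_nat (leq0n K) (ltnW Km))/= [X in _ + X]big_nat.
    by rewrite [X in _ + X]big1 ?addr0// => k /andP[Kk _]; rewrite aK// cabs0 expr0n.
  rewrite expr1n (_ : \sum_(_ <= _ < _) _ = X / sigma ^+ 2).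
    by rewrite sX divff.
  rewrite /X mulr_suml; apply: eq_big_nat => k /andP[_ kK].
  by rewrite /a cabs_real ger0_norm// /alpha kK expr_div_n.
have f1 := H2norm_le_coef fa ler01 a1.
have fH : H2 f.
  split; first exact: represents_analytic_disc fa.
  by apply: le_lt_trans f1 _; rewrite ltry.
have Tf := TM f fH f1.
have TgM z : cabs z < 1 -> cabs (Tg g f z) <= M.
  move=> /disc_cabs z1; rewrite -lee_fin; apply: le_trans Tf.
  by apply: ereal_sup_ubound; exists z.
have Tfa := represents_Tg_coef gm fa.
(* The part of the expansion of [Tg g f] at [x] over the rectangle [k < K], [l < n]. *)
pose Y (x : R) := \sum_(0 <= k < K) \sum_(0 <= l < n)
  alpha k * b l * x ^+ (l + k).+1 / (l + k + 1)%:R.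
have YM x : 0 < x < 1 -> Y x <= M.
  move=> /andP[x0 x1].
  have cx : cabs (x%:C : C) < 1 by rewrite cabs_real ger0_norm ?(ltW x0).
  apply: le_trans (TgM _ cx).
  have := Tfa x%:C; rewrite subr0 => /(_ cx) /cvg_cabs/cvgr_to_ge; apply.
  (* Once [K + n <= m], the triangle of indices contains the rectangle, and the remaining terms are
     nonnegative. *)
  exists (K + n).+1 => // -[//|m] /= Km; rewrite ltnS in Km.
  rewrite power_series_Tg_coef.
  pose y k l := alpha k * b l * x ^+ (l + k).+1 / (l + k + 1)%:R.
  have y0 k l : 0 <= y k l.
    by rewrite /y divr_ge0// mulr_ge0 ?mulr_ge0 ?exprn_ge0 ?(ltW x0).
  rewrite (_ : \sum_(_ <= _ < _) _ =
      (\sum_(0 <= k < m) \sum_(0 <= l < m - k) y k l)%:C); last first.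
    rewrite rmorph_sum/=; apply: eq_bigr => k _.
    rewrite rmorph_sum/=; apply: eq_bigr => l _.
    by rewrite /y fmorph_div rmorph_nat !rmorphM rmorphXn.
  rewrite cabs_real ger0_norm; last first.
    by apply: sumr_ge0 => k _; exact: sumr_ge0.
  have KmN : (K <= m)%N by rewrite (leq_trans _ Km)// leq_addr.
  rewrite [leRHS](big_cat_nat (leq0n K) KmN)/= -[leLHS]addr0; apply: lerD; last first.
    by apply: sumr_ge0 => k _; exact: sumr_ge0.
  apply: ler_sum_nat => k /andP[_ kK].
  have nk : (n <= m - k)%N.
    by rewrite leq_subRL ?(leq_trans (ltnW kK))// (leq_trans _ Km)// leq_add2r ltnW.
  rewrite [leRHS](big_cat_nat (leq0n n) nk)/= lerDl.
  exact: sumr_ge0.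
have cY : Y x @[x --> (1 : R)^'-] --> Y 1.
  apply: cvg_at_left_filter.
  apply: cvg_sumr => k; apply: cvg_sumr => l.
  by apply: cvgMl; apply: cvgMr; exact: exprn_continuous.
have : Y 1 <= M.
  apply: (cvgr_to_le cY); near=> x; apply: YM; apply/andP; split; near: x.
    exact: nbhs_left_gt.
  exact: nbhs_left_lt.
have -> : Y 1 = sigma.
  transitivity (X / sigma); last by rewrite -sX expr2 mulfK ?gt_eqF.
  rewrite /X mulr_suml; apply: eq_big_nat => k /andP[_ kK].
  transitivity (alpha k * hilbert_partial b k n).
    by rewrite mulr_sumr; apply: eq_bigr => l _; rewrite expr1n mulr1 mulrA.
  by rewrite /alpha kK expr2 mulrAC.
by move=> sM; rewrite -sX lerXn2r// nnegrE ltW.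
Unshelve. all: by end_near. Qed.

End TgCoef.

(** * Compactness and the Hilbert sum *)

Section Subsequences.
Context {R : realType}.
Local Notation C := R[i]^o.

(** Tychonoff's theorem, with one real coordinate for each real and imaginary part, gives a cluster
    point of the sequence. The subsequence is then chosen so that its term [j] is close to it in the
    coordinates up to [j]. *)
Lemma bounded_sequences_extract (a_ : nat -> nat -> C) (A : R) :
  (forall j k, cabs (a_ j k) <= A) ->
  exists (s : nat -> nat) (a : nat -> C),
    {homo s : m n / (m < n)%N} /\
    forall k, cabs (a_ (s j) k - a k) @[j --> \oo] --> (0 : R).
Proof.
move=> aA; pose T := fun _ : nat * bool => (R : topologicalType).
pose x j : prod_topology T := fun i : nat * bool =>
  if i.2 then complex.Re (a_ j i.1) else complex.Im (a_ j i.1).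
have cK := @tychonoff _ T (fun=> `[- A, A]%classic)
  (fun=> @segment_compact R (- A) A).
have [|p [_ clp]] := cK (x j @[j --> \oo]) (fmap_proper_filter x _).
  exists 0%N => // j _ [k c] /=; rewrite in_itv/= -ler_norml.
  apply: le_trans (aA j k); rewrite /x/=.
  by case: c; [exact: ler_Re_cabs|exact: ler_Im_cabs].
have near1 i (e : R) : 0 < e -> \forall f \near p, `|(p i : R) - f i| < e.
  move=> e0; have pi : (fun f : prod_topology T => f i : R) @ p --> (p i : R).
    exact: (@proj_continuous _ T i p).
  exact: ((cvgrPdist_lt _ (p i : R)).1 pi e e0).
have nearm m (e : R) : 0 < e -> \forall f \near p,
    forall k c, (k <= m)%N -> `|(p (k, c) : R) - f (k, c)| < e.
  move=> e0; elim: m => [|m IH].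
    near=> f => k c; rewrite leqn0 => /eqP ->.
    by case: c; near: f; exact: near1.
  near=> f => k c; rewrite leq_eqVlt => /predU1P[->|].
    by case: c; near: f; exact: near1.
  by rewrite ltnS; move: k c; near: f; exact: IH.
pose a k : C := p (k, true) +i* p (k, false).
(* The factor 2 adds the errors of the real and imaginary parts. *)
have ex (mN : nat * nat) : exists j, (mN.2 <= j)%N /\
    forall k, (k <= mN.1)%N -> cabs (a_ j k - a k) < 2 * mN.1.+1%:R^-1.
  case: mN => m N /=.
  have e0 : 0 < m.+1%:R^-1 :> R by rewrite invr_gt0.
  have [|_ [[j Nj <-] xj]] := clp [set x j | j in [set j | (N <= j)%N]] _ _ (nearm m _ e0).
    by exists N => // j /= Nj; exists j.
  exists j; split=> // k km.
  apply: le_lt_trans (cabs_le_ReIm _) _; rewrite !raddfB/= mulr_natl mulr2n.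
  have := xj k true km; have := xj k false km; rewrite /x/= => h1 h2.
  by rewrite ltrD// distrC.
have [phi phiP] := choice ex.
(* Searching from [(s i).+1] on makes [s] strictly increasing. *)
pose s := fix s j := if j is i.+1 then phi (i.+1, (s i).+1) else phi (0%N, 0%N).
have sS j : (s j < s j.+1)%N by have [] := phiP (j.+1, (s j).+1).
have sP j k : (k <= j)%N -> cabs (a_ (s j) k - a k) < 2 * j.+1%:R^-1.
  by case: j => [|j]; [have [_] := phiP (0%N, 0%N)|
    have [_] := phiP (j.+1, (s j).+1)]; apply.
exists s, a; split; first exact: (homo_ltn ltn_trans sS).
move=> k; have c0 : 2 * j.+1%:R^-1 @[j --> \oo] --> (0 : R).
  rewrite -[X in _ --> X](mulr0 2); apply: cvgMr; exact: cvg_harmonic.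
apply: (squeeze_cvgr _ (cvg_cst 0) c0); exists k => // j /= kj.
by rewrite cabs_ge0 ltW// sP.
Unshelve. all: by end_near. Qed.

End Subsequences.

(** * The extended-real sum and its real truncations *)

Section HilbertSum.
Context {R : realType}.
Implicit Types (ghat : nat -> R) (M : R).
Local Notation coef ghat := (fun n => n.+1%:R * ghat n.+1).

Lemma hilbert_partialE ghat k n :
  (hilbert_partial (coef ghat) k n)%:E =
  (\sum_(0 <= l < n) (l.+1%:R * ghat l.+1 / (l + k + 1)%:R)%:E)%E.
Proof. by rewrite /hilbert_partial sumEFin. Qed.

Lemma hilbert_sum_finite ghat : (forall n, 0 <= ghat n) ->
  (hilbert_sum ghat < +oo)%E -> exists (S : nat -> R) H,
  [/\ 0 <= H, hilbert_sum ghat = (H ^+ 2)%:E,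
      forall k n, hilbert_partial (coef ghat) k n <= S k &
      forall n, \sum_(0 <= k < n) S k ^+ 2 <= H ^+ 2].
Proof.
move=> g0 hfin.
pose s k := (\sum_(0 <= n <oo) (n.+1%:R * ghat n.+1 / (n + k + 1)%:R)%:E)%E.
have t0 k n : (0 <= (n.+1%:R * ghat n.+1 / (n + k + 1)%:R)%:E)%E.
  by rewrite lee_fin divr_ge0 ?mulr_ge0.
have s0 k : (0 <= s k)%E by apply: nneseries_ge0.
have s20 k : (0 <= s k ^+ 2)%E by exact: expe_ge0.
have h0 : (0 <= hilbert_sum ghat)%E.
  by apply: nneseries_ge0 => k _ _; exact: s20.
have partial_le n : (\sum_(0 <= k < n) s k ^+ 2 <= hilbert_sum ghat)%E.
  by apply: nneseries_lim_ge => k _ _; exact: s20.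
(* An infinite inner sum would have an infinite square and make the outer sum infinite. *)
have sfin k : s k \is a fin_num.
  rewrite ge0_fin_numE// ltNge leye_eq; apply/negP => /eqP sky.
  have := partial_le k.+1; rewrite big_nat_recr//.
  have -> : (s k ^+ 2 = +oo)%E by rewrite sky expe2 mulyy.
  rewrite /= addey; first by rewrite leye_eq (lt_eqF hfin).
  rewrite -ltNye; apply: (@lt_le_trans _ _ 0%E); first exact: ltNy0.
  by apply: sume_ge0 => i _; exact: s20.
have hE : hilbert_sum ghat = (Num.sqrt (fine (hilbert_sum ghat)) ^+ 2)%:E.
  by rewrite sqr_sqrtr ?fine_ge0// fineK// ge0_fin_numE.
exists (fine \o s), (Num.sqrt (fine (hilbert_sum ghat))); split=> //.
- move=> k n; rewrite -lee_fin hilbert_partialE /= fineK//.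
  by apply: nneseries_lim_ge => l _ _; exact: t0.
- move=> n; rewrite -lee_fin -hE -sumEFin; apply: le_trans (partial_le n).
  by apply: lee_sum => k _; rewrite /= EFin_expe fineK.
Qed.

(** The inner truncation is removed first, for a finite outer sum: each inner sum is monotone and
    bounded by [M]. The outer truncation is removed afterwards. *)
Lemma hilbert_sum_le ghat M : (forall n, 0 <= ghat n) -> 0 <= M ->
  (forall K n, \sum_(0 <= k < K) hilbert_partial (coef ghat) k n ^+ 2 <= M ^+ 2) ->
  (hilbert_sum ghat <= (M ^+ 2)%:E)%E.
Proof.
move=> g0 M0 hM; set b := coef ghat in hM *.
have b0 l : 0 <= b l by rewrite /b mulr_ge0.
have hp k n : hilbert_partial b k n <= M.
  rewrite -(ler_pXn2r (ltn0Sn 1)) ?nnegrE ?hilbert_partial_ge0//.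
  apply: le_trans (hM k.+1 n); rewrite big_nat_recr//= lerDr.
  by apply: sumr_ge0 => i _; exact: sqr_ge0.
have cv k : hilbert_partial b k n @[n --> \oo] -->
    limn (hilbert_partial b k).
  apply: nondecreasing_is_cvgn.
    by move=> m n mn; exact: hilbert_partial_le.
  by exists M => _ [n _ <-]; exact: hp.
have sE k : (\sum_(0 <= n <oo) (n.+1%:R * ghat n.+1 / (n + k + 1)%:R)%:E)%E =
    (limn (hilbert_partial b k))%:E.
  apply: cvg_lim => //.
  have -> : (fun n => \sum_(0 <= l < n)
      (l.+1%:R * ghat l.+1 / (l + k + 1)%:R)%:E)%E = EFin \o hilbert_partial b k.
    by apply/funext => n; rewrite -hilbert_partialE.
  by apply: cvg_EFin; [exact: nearW|exact: cv].
rewrite /hilbert_sum; apply: lime_le.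
  apply: is_cvg_nneseries => k _ _; apply: expe_ge0.
  by apply: nneseries_ge0 => n _ _; rewrite lee_fin divr_ge0 ?mulr_ge0.
apply: nearW => K.
under eq_bigr do rewrite sE -EFin_expe.
rewrite sumEFin lee_fin.
have cK : \sum_(0 <= k < K) hilbert_partial b k n ^+ 2 @[n --> \oo] -->
    \sum_(0 <= k < K) limn (hilbert_partial b k) ^+ 2.
  by apply: cvg_sumr => k; apply: cvgM; exact: cv.
apply: (cvgr_to_le cK); apply: nearW => n; exact: hM.
Qed.

End HilbertSum.

(** * The operator norm and the equivalences *)

Section Main.
Context {R : realType}.
Local Notation C := R[i]^o.
Implicit Types (f h : C -> C).

Section Symbol.
Variables (g : C -> C) (ghat : nat -> R).
Hypothesis gm : maclaurin g ghat.
Hypothesis g0 : forall n, 0 <= ghat n.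
Let b n : R := n.+1%:R * ghat n.+1.

Let b0 l : 0 <= b l. Proof. by rewrite /b mulr_ge0. Qed.

Lemma Tg_H2_Hoo : (hilbert_sum ghat < +oo)%E -> exists H : R, [/\ 0 <= H,
  hilbert_sum ghat = (H ^+ 2)%:E & forall f, H2 f ->
    Hoo (Tg g f) /\ (Hoonorm (Tg g f) <= H%:E * H2norm f)%E].
Proof.
move=> /(hilbert_sum_finite g0)[S [H [H0 hH bS SH]]]; exists H; split=> // f.
move=> /H2_represents[a [A [fa A0 fA aA]]].
have Tfa := represents_Tg_coef gm fa.
have le : (Hoonorm (Tg g f) <= (A * H)%:E)%E.
  by apply: Hoonorm_le => z; exact: (Tg_coef_bound b0 bS H0 SH A0 aA Tfa).
split; last by rewrite fA -EFinM mulrC.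
split; first exact: represents_analytic_disc Tfa.
by apply: le_lt_trans le _; exact: ltry.
Qed.

Lemma hilbert_sum_le_Tg (M : R) : 0 <= M ->
  (forall f, H2 f -> (H2norm f <= 1)%E -> (Hoonorm (Tg g f) <= M%:E)%E) ->
  (hilbert_sum ghat <= (M ^+ 2)%:E)%E.
Proof.
by move=> M0 TM; apply: hilbert_sum_le => //; exact: (hilbert_partial_sum_le gm g0).
Qed.

(** The zero function lies in the unit ball, so the supremum is not over the empty set, where it
    would be [-oo]. *)
Lemma opnorm_Tg_ge0 : (0 <= opnorm_H2_Hoo (Tg g))%E.
Proof.
have f0 := @represents_polynomial R (fun=> 0) 0%N (fun _ _ => erefl).
set f := (fun z => _) in f0.
have f1 : (H2norm f <= 0%:E)%E.
  apply: (H2norm_le_coef f0) => // n; rewrite big1 ?expr0n// => k _.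
  by rewrite cabs0 expr0n.
apply: le_trans (Hoonorm_ge0 (Tg g f)) _; apply: ereal_sup_ubound; exists f => //=.
split; last by apply: le_trans f1 _; rewrite lee_fin ler01.
by split; [exact: represents_analytic_disc f0|apply: le_lt_trans f1 _; exact: ltry].
Qed.

Lemma opnorm_Tg_sqr : (opnorm_H2_Hoo (Tg g) ^+ 2)%E = hilbert_sum ghat.
Proof.
have op0 := opnorm_Tg_ge0; apply/eqP; rewrite eq_le; apply/andP; split.
  have [/Tg_H2_Hoo[H [H0 -> TH]]|] := ltP (hilbert_sum ghat) +oo%E; last first.
    by rewrite leye_eq => /eqP ->; rewrite leey.
  rewrite EFin_expe lee_sqr//; apply: ub_ereal_sup => _ [f [fH f1] <-].
  apply: (le_trans (TH f fH).2); rewrite -[leRHS]mule1.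
  by apply: lee_wpmul2l; rewrite // lee_fin.
have : forall f, H2 f -> (H2norm f <= 1)%E ->
    (Hoonorm (Tg g f) <= opnorm_H2_Hoo (Tg g))%E.
  by move=> f fH f1; apply: ereal_sup_ubound; exists f.
(* A finite norm serves as the constant [M] of the lower bound; an infinite one leaves nothing to
   prove. *)
case: (opnorm_H2_Hoo (Tg g)) op0 => [M|_ _|//].
  by rewrite lee_fin => M0 /(hilbert_sum_le_Tg M0); rewrite EFin_expe.
by rewrite expe2 mulyy leey.
Qed.

Lemma bounded_Tg_iff :
  bounded_H2_Hoo (Tg g) <-> (hilbert_sum ghat < +oo)%E.
Proof.
split=> [[M TM]|/Tg_H2_Hoo[H [_ _ TH]]]; last by exists H.
(* The constant in [bounded_H2_Hoo] may be negative. *)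
pose M' := Num.max M 0.
have M0 : 0 <= M' by rewrite le_max lexx orbT.
apply: le_lt_trans (ltry (M' ^+ 2)); apply: hilbert_sum_le_Tg => // f fH f1.
apply: (le_trans (TM f fH).2).
apply: (@le_trans _ _ (M'%:E * H2norm f)%E).
  by apply: lee_wpmul2r; [exact: H2norm_ge0|rewrite lee_fin le_max lexx].
by rewrite -[leRHS]mule1; apply: lee_wpmul2l; rewrite // lee_fin.
Qed.

(** If the sum were infinite, the unit ball would contain functions [f_ n] with images of norm above
    [n]. A convergent subsequence of images is eventually bounded, which contradicts [n <= s n]. *)
Lemma compact_Tg_finite :
  compact_H2_Hoo (Tg g) -> (hilbert_sum ghat < +oo)%E.
Proof.
move=> [_ cpt]; rewrite ltey; apply/eqP => hy.
have : forall n : nat, exists f, [/\ H2 f, (H2norm f <= 1)%E &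
    (n%:R%:E < Hoonorm (Tg g f))%E].
  move=> n; apply: contrapT => nex.
  suff : (hilbert_sum ghat <= (n%:R ^+ 2)%:E)%E by rewrite hy leye_eq.
  apply: hilbert_sum_le_Tg => // f fH f1; rewrite leNgt; apply/negP => nf.
  by apply: nex; exists f.
move=> /choice[f_ f_P].
have [|s [h [sinc [_ hoo] cv]]] := cpt f_.
  by exists 1 => n; have [] := f_P n.
have hfin : Hoonorm h = (fine (Hoonorm h))%:E.
  by rewrite fineK// ge0_fin_numE ?Hoonorm_ge0.
have /fine_cvgP[fcv /cvgrPdist_lt/(_ 1 ltr01) dcv] := cv.
have sle n : (n <= s n)%N.
  by elim: n => // n IH; apply: leq_ltn_trans IH _; exact: sinc.
near \oo => n.
have : (Hoonorm (Tg g (f_ (s n))) <= (1 + fine (Hoonorm h))%:E)%E.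
  apply: Hoonorm_le => z z1.
  rewrite -[Tg g (f_ (s n)) z](subrK (h z)) (le_trans (cabsD _ _))//.
  apply: lerD.
    rewrite -lee_fin; apply: (@le_trans _ _
        (Hoonorm (fun z => Tg g (f_ (s n)) z - h z))).
      by apply: ereal_sup_ubound; exists z => //; exact/disc_cabs.
    rewrite -[leLHS]fineK; last by near: n.
    rewrite lee_fin; apply/ltW/(le_lt_trans (ler_norm _)).
    by rewrite -normrN -sub0r; near: n.
  rewrite -lee_fin -hfin.
  by apply: ereal_sup_ubound; exists z => //; exact/disc_cabs.
have [_ _ /lt_le_trans/[apply]] := f_P (s n).
rewrite lte_fin ltNge => /negP; apply.
apply: (@le_trans _ _ n%:R); last by rewrite ler_nat.
by near: n; exact: nbhs_infty_ger.
Unshelve. all: by end_near. Qed.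

(** Extract a subsequence whose coefficients converge to some [a], which inherits the l^2 bound [A].
    The limit [h] is the sum of the series with coefficients [Tg_coef b a]; the differences [d j]
    have l^2 norm at most [2 * A] and tend to 0 coefficientwise, so [Tg_coef_cvg0] applies. *)
Lemma finite_compact_Tg :
  (hilbert_sum ghat < +oo)%E -> compact_H2_Hoo (Tg g).
Proof.
move=> hfin; have [H1 [_ _ TH]] := Tg_H2_Hoo hfin.
split; first by move=> f fH; have [] := TH f fH.
have [S [H [H0 hH bS SH]]] := hilbert_sum_finite g0 hfin.
move=> f_ [A fA].
have A0 : 0 <= A.
  by rewrite -lee_fin; apply: le_trans (fA 0%N).2; exact: H2norm_ge0.
have : forall j, exists a, represents (f_ j) 0 a 1 /\
    forall n, \sum_(0 <= k < n) cabs (a k) ^+ 2 <= A ^+ 2.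
  move=> j; have [/H2_represents[a [_ [fa _ _ _]]] fjA] := fA j.
  by exists a; split=> //; exact: H2norm_coef_le fjA.
move=> /choice[a_ /all_and2[fa aA]].
have aA1 j k : cabs (a_ j k) <= A.
  rewrite -(ler_pXn2r (ltn0Sn 1)) ?nnegrE ?cabs_ge0//.
  apply: le_trans (aA j k.+1); rewrite big_nat_recr//= lerDr.
  by apply: sumr_ge0 => i _; exact: sqr_ge0.
have [s [a [sinc acv]]] := bounded_sequences_extract aA1.
have aA' n : \sum_(0 <= k < n) cabs (a k) ^+ 2 <= A ^+ 2.
  have cv : \sum_(0 <= k < n) cabs (a_ (s j) k) ^+ 2 @[j --> \oo] -->
      \sum_(0 <= k < n) cabs (a k) ^+ 2.
    apply: cvg_sumr => k; have /cvg_cabsP/cvg_cabs c := acv k.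
    by apply: cvgM; exact: c.
  by apply: (cvgr_to_le cv); apply: nearW => j; exact: aA.
have [h ha] := Tg_coef_represents b0 bS H0 SH A0 aA'.
have hbound z : cabs z < 1 -> cabs (h z) <= A * H.
  exact: (Tg_coef_bound b0 bS H0 SH A0 aA' ha).
exists s, h; split=> //.
  split; first exact: represents_analytic_disc ha.
  by apply: le_lt_trans (Hoonorm_le hbound) _; exact: ltry.
pose d j k : C := a_ (s j) k - a k.
pose D j : C -> C := fun z => Tg g (f_ (s j)) z - h z.
have Dd j : represents (D j) 0 (Tg_coef b (d j)) 1.
  have := represents_sub (represents_Tg_coef gm (fa (s j))) ha.
  by rewrite (_ : (fun n => _) = Tg_coef b (d j))//; apply/funext => n; exact: Tg_coefB.
have dA j n : \sum_(0 <= k < n) cabs (d j k) ^+ 2 <= (2 * A) ^+ 2.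
  apply: (@le_trans _ _ (\sum_(0 <= k < n)
      (2 * cabs (a_ (s j) k) ^+ 2 + 2 * cabs (a k) ^+ 2))).
    apply: ler_sum => k _.
    apply: (@le_trans _ _ ((cabs (a_ (s j) k) + cabs (a k)) ^+ 2)).
      by rewrite lerXn2r ?nnegrE ?addr_ge0 ?cabs_ge0//; exact: cabsB.
    rewrite -subr_ge0 (_ : _ - _ = (cabs (a_ (s j) k) - cabs (a k)) ^+ 2).
      exact: sqr_ge0.
    by ring.
  rewrite big_split/= -!mulr_sumr; have := aA (s j) n; have := aA' n.
  by rewrite exprMn; lra.
have A20 : 0 <= 2 * A by rewrite mulr_ge0.
have Dcv e : 0 < e -> \forall j \near \oo, (Hoonorm (D j) <= e%:E)%E.
  move=> e0; have := Tg_coef_cvg0 b0 bS SH A20 dA Dd acv e0.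
  by apply: filterS => j; exact: Hoonorm_le.
apply/fine_cvgP; split.
  apply: filterS (Dcv 1 ltr01) => j D1.
  rewrite ge0_fin_numE ?Hoonorm_ge0//; apply: le_lt_trans D1 _; exact: ltry.
apply/cvgrPdist_le => e e0; apply: filterS (Dcv e e0) => j De.
rewrite sub0r normrN /= ger0_norm ?fine_ge0 ?Hoonorm_ge0//.
by rewrite -lee_fin fineK// ge0_fin_numE ?Hoonorm_ge0// (le_lt_trans De)// ltry.
Qed.

End Symbol.
End Main.

Theorem theorem5p1 (R : realType) :
  (forall (g : R[i]^o -> R[i]^o) (ghat : nat -> R),
     analytic_disc g -> maclaurin g ghat -> (forall n, 0 <= ghat n) ->
     (bounded_H2_Hoo (Tg g) <-> (hilbert_sum ghat < +oo)%E) /\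
     ((hilbert_sum ghat < +oo)%E <-> compact_H2_Hoo (Tg g))) /\
  (exists c C : R, 0 < c /\ 0 < C /\
     forall (g : R[i]^o -> R[i]^o) (ghat : nat -> R),
       analytic_disc g -> maclaurin g ghat -> (forall n, 0 <= ghat n) ->
       (c%:E * hilbert_sum ghat <= opnorm_H2_Hoo (Tg g) ^+ 2)%E /\
       (opnorm_H2_Hoo (Tg g) ^+ 2 <= C%:E * hilbert_sum ghat)%E).
Proof.
split=> [g ghat _ gm g0|].
  split; first exact: bounded_Tg_iff.
  by split; [exact: finite_compact_Tg|exact: compact_Tg_finite].
exists 1, 1; split=> //; split=> // g ghat _ gm g0.
by rewrite mul1e (opnorm_Tg_sqr gm g0).
Qed.
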